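(* Let $A$ be a two-dimensional AS regular algebra which is not commutative; up to isomorphism $A$ is either $\Bbbk_q[u,v]$ with $q\in\Bbbk^\times$, $q\neq 1$, or $\Bbbk_J[u,v]$. Let $G$ be a nontrivial small subgroup of $\mathrm{Aut}_{\mathrm{gr}}(A)$. Then, up to conjugation of $G$ by an element of $\mathrm{Aut}_{\mathrm{gr}}(A)$, exactly one of the following holds: (i) $A=\Bbbk_q[u,v]$ with $q\neq 1$ and $G=\frac1n(1,a)$, the cyclic group generated by $\begin{pmatrix}\omega_n&0\\0&\omega_n^a\end{pmatrix}$, where $1\le a<n$ and $\gcd(a,n)=1$; (ii) $A=\Bbbk_{-1}[u,v]$ and $G=G_{n,k}$ with $\gcd(n,k)=1$ and $k\not\equiv 2 \pmod 4$; (iii) $A=\Bbbk_J[u,v]$ and $G=\frac1n(1,1)$, the cyclic group generated by $\begin{pmatrix}\omega_n&0\\0&\omega_n\end{pmatrix}$, with $n\ge 2$. Conversely, every group listed (acting on the listed algebra) is a small subgroup of $\mathrm{Aut}_{\mathrm{gr}}(A)$.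
   Context: $\Bbbk$ is an algebraically closed field of characteristic $0$, and $\omega_n$ denotes a primitive $n$th root of unity. $\Bbbk_q[u,v]=\Bbbk\langle u,v\rangle/(vu-quv)$ ($q\in\Bbbk^\times$) and $\Bbbk_J[u,v]=\Bbbk\langle u,v\rangle/(vu-uv-u^2)$, graded with $\deg u=\deg v=1$; both have Hilbert series $(1-t)^{-2}$. A matrix $g=\begin{pmatrix}a&b\\c&d\end{pmatrix}\in \mathrm{GL}(2,\Bbbk)$ acts (when it defines a graded automorphism) by $g\cdot u=au+cv$, $g\cdot v=bu+dv$; in this way $\mathrm{Aut}_{\mathrm{gr}}(A)$ is identified with a subgroup of $\mathrm{GL}(2,\Bbbk)$. For a graded automorphism $g$ of $A$, its trace is $\mathrm{Tr}_A(g)=\sum_{i\ge0}\mathrm{tr}(g|_{A_i})\,t^i$. Such $g$ is a quasi-reflection if $\mathrm{Tr}_A(g)=\frac{1}{(1-t)p(t)}$ with $p(1)\neq0$ (equivalently here, $\mathrm{Tr}_A(g)=\frac{1}{(1-t)(1-\lambda t)}$ for some $\lambda\ne1$). A finite subgroup of $\mathrm{Aut}_{\mathrm{gr}}(A)$ is small if it contains no quasi-reflections. For positive integers $n,k$, let $\omega$ be a primitive $(2nk)$th root of unity and $G_{n,k}=\left\langle \begin{pmatrix}\omega^{2k}&0\\0&\omega^{-2k}\end{pmatrix},\begin{pmatrix}0&\omega^{n}\\\omega^{n}&0\end{pmatrix}\right\rangle\le \mathrm{Aut}_{\mathrm{gr}}(\Bbbk_{-1}[u,v])$ (so the generators are $\mathrm{diag}(\omega_n,\omega_n^{-1})$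 and the antidiagonal matrix with both entries a primitive $2k$th root of unity). *)

(* Defs.v *)
From HB Require Import structures.
From mathcomp Require Import all_boot all_order all_algebra.
Set Implicit Arguments.
Unset Strict Implicit.
Unset Printing Implicit Defensive.
Import GRing.Theory.
Local Open Scope ring_scope.

Section Defs.
Variable F : fieldType.

(* Which noncommutative 2-dimensional AS regular algebra:
   Kq q = k_q[u,v] = k<u,v>/(vu - q uv);  KJ = k_J[u,v] = k<u,v>/(vu - uv - u^2). *)
Inductive alg := Kq of F | KJ.

Definition mx2 (a b c d : F) : 'M[F]_2 :=
  \matrix_(i < 2, j < 2)
    if (i == 0 :> nat) then (if (j == 0 :> nat) then a else b)
    else (if (j == 0 :> nat) then c else d).

(* Free algebra k<u,v>: the degree-m component T_m = V^{(x)m} has dimension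
   tdim m = 2^m.  T_{m+1} = V (x) T_m, a vector of T_{m+1} being the mxvec of a
   2 x tdim m matrix whose row l is the T_m-part following the first letter l
   (letter 0 = u, letter 1 = v).  Vectors are row vectors. *)
Fixpoint tdim (m : nat) : nat := if m is m'.+1 then (2 * tdim m')%N else 1%N.

(* left multiplication by the letter l : T_m -> T_{m+1} *)
Definition lt (m : nat) (l : 'I_2) (y : 'rV[F]_(tdim m)) : 'rV[F]_(tdim m.+1) :=
  mxvec (delta_mx l (0 : 'I_1) *m y).

Definition lu : 'I_2 := 0.
Definition lv : 'I_2 := 1.
Definition one0 : 'rV[F]_(tdim 0) := 1%:M.

Definition rel (A : alg) : 'rV[F]_(tdim 2) :=
  match A with
  | Kq q => lt lv (lt lu one0) - q *: lt lu (lt lv one0)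
  | KJ => lt lv (lt lu one0) - lt lu (lt lv one0) - lt lu (lt lu one0)
  end.

(* For M the matrix of a linear map of V acting on row vectors,
   tpow M m is the matrix of M^{(x)m} acting on T_m. *)
Fixpoint tpow (M : 'M[F]_2) (m : nat) : 'M[F]_(tdim m) :=
  match m return 'M[F]_(tdim m) with
  | 0 => 1%:M
  | m'.+1 => lin1_mx (fun x : 'rV[F]_(2 * tdim m') =>
                        mxvec (M^T *m vec_mx x *m tpow M m'))
  end.

(* r (x) y for r in T_2, y in T_m *)
Definition rtens (r : 'rV[F]_(tdim 2)) (m : nat) (y : 'rV[F]_(tdim m))
  : 'rV[F]_(tdim m.+2) :=
  mxvec (\matrix_(a < 2) mxvec (vec_mx (row a (vec_mx r)) *m y)).

(* I_m : (a square matrix whose row space is) the degree-m component of the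
   two-sided ideal generated by r, defined by
   I_0 = I_1 = 0, I_{m+2} = V (x) I_{m+1} + r (x) T_m. *)
Fixpoint Ideal (r : 'rV[F]_(tdim 2)) (m : nat) {struct m} : 'M[F]_(tdim m) :=
  match m return 'M[F]_(tdim m) with
  | 0 => 0
  | m1.+1 =>
      match m1 return 'M[F]_(tdim m1) -> 'M[F]_(tdim m1.+1) with
      | 0 => fun _ => 0
      | m'.+1 => fun I1 =>
          (I1 *m lin1_mx (@lt m'.+1 lu) + I1 *m lin1_mx (@lt m'.+1 lv)
           + lin1_mx (@rtens r m'))%MS
      end (Ideal r m1)
  end.

(* g = [[a,b],[c,d]] acts by g.u = a u + c v, g.v = b u + d v, i.e. on row
   coordinate vectors by x |-> x *m g^T. *)

(* g defines a graded automorphism of A: g is invertible and the induced map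
   of the free algebra preserves the ideal (equivalently, its degree-2 part). *)
Definition isAut (A : alg) (g : 'M[F]_2) : Prop :=
  g \in unitmx /\ (rel A *m tpow g^T 2 <= rel A)%MS.

(* tr(g | A_m), where A_m = T_m / I_m: trace on T_m minus trace on I_m *)
Definition trA (A : alg) (g : 'M[F]_2) (m : nat) : F :=
  let B := row_base (Ideal (rel A) m) in
  \tr (tpow g^T m) - \tr (B *m tpow g^T m *m pinvmx B).

(* g is a quasi-reflection: Tr_A(g) = 1/((1-t) p(t)) with p(1) != 0, i.e.
   the power series Tr_A(g) * (1 - t) * p(t) equals 1. *)
Definition quasi_reflection (A : alg) (g : 'M[F]_2) : Prop :=
  exists p : {poly F}, p.[1] != 0 /\
    forall m : nat,
      \sum_(j < m.+1) ((1 - 'X) * p)`_j * trA A g (m - j) = (m == 0%N)%:R.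

(* G (listed without repetition or with, as a finite list) is a finite
   subgroup of Aut_gr(A) *)
Definition fin_subgroup (A : alg) (G : seq 'M[F]_2) : Prop :=
  [/\ 1%:M \in G,
      (forall g, g \in G -> isAut A g),
      (forall g h, g \in G -> h \in G -> g *m h \in G) &
      (forall g, g \in G -> invmx g \in G)].

Definition small (A : alg) (G : seq 'M[F]_2) : Prop :=
  fin_subgroup A G /\ (forall g, g \in G -> ~ quasi_reflection A g).

Definition nontrivial (G : seq 'M[F]_2) : Prop :=
  exists2 g, g \in G & g != 1%:M.

(* x lies in the monoid generated by S (= group generated by S, since all
   our generators have finite order) *)
Definition gen (S : seq 'M[F]_2) (x : 'M[F]_2) : Prop :=
  exists ws : seq 'M[F]_2, (forall s, s \in ws -> s \in S) /\
                           x = foldr mulmx 1%:M ws.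

Definition conj_to (A : alg) (G : seq 'M[F]_2) (S : seq 'M[F]_2) : Prop :=
  exists h, isAut A h /\
    forall x, (exists2 g, g \in G & x = h *m g *m invmx h) <-> gen S x.

Definition noncomm (A : alg) : bool :=
  if A is Kq q then (q != 0) && (q != 1) else true.

Definition caseI (A : alg) (G : seq 'M[F]_2) : Prop :=
  (exists q, A = Kq q /\ q != 1) /\
  exists (n a : nat) (w : F),
    [/\ (1 <= a < n)%N, coprime a n, n.-primitive_root w &
        conj_to A G [:: mx2 w 0 0 (w ^+ a)]].

Definition Gnk (n k : nat) (w : F) : seq 'M[F]_2 :=
  [:: mx2 (w ^+ (2 * k)) 0 0 (w ^- (2 * k)); mx2 0 (w ^+ n) (w ^+ n) 0].

Definition caseII (A : alg) (G : seq 'M[F]_2) : Prop :=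
  A = Kq (-1) /\
  exists (n k : nat) (w : F),
    [/\ (0 < n)%N, (0 < k)%N, coprime n k, (k %% 4 != 2)%N &
        (2 * n * k).-primitive_root w /\ conj_to A G (Gnk n k w)].

Definition caseIII (A : alg) (G : seq 'M[F]_2) : Prop :=
  A = KJ /\
  exists (n : nat) (w : F),
    [/\ (2 <= n)%N, n.-primitive_root w & conj_to A G [:: mx2 w 0 0 w]].

End Defs.

Arguments KJ {F}.

Definition exactly_one (P Q R : Prop) : Prop :=
  (P /\ ~ Q /\ ~ R) \/ (~ P /\ Q /\ ~ R) \/ (~ P /\ ~ Q /\ R).

(* Main.v *)
Require Import Defs.
From HB Require Import structures.
From mathcomp Require Import all_boot all_order all_algebra cyclic.
From mathcomp Require Import ring zify.
Set Implicit Arguments.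
Unset Strict Implicit.
Unset Printing Implicit Defensive.
Import GRing.Theory.
Local Open Scope ring_scope.

(** The words [u^i v^j] form a basis of [A], so [Tr_A(g)] is computed on normal
    forms: it is [1/((1-xt)(1-yt))] for a diagonal [g = diag(x,y)] and
    [1/(1+bct^2)] for an antidiagonal [g] with entries [b, c] acting on
    [k_{-1}[u,v]].  Hence a diagonal [g] is a quasi-reflection iff exactly one
    of [x, y] is [1], and an antidiagonal one iff [bc = -1].

    Apart from [k_{-1}], finite groups of automorphisms are diagonal (in
    characteristic 0 the unipotent part vanishes for [k_J]).  A small diagonal
    group projects injectively to each coordinate, so it is
    [<diag(w, w^a)>] with [w] a primitive [m]-th root of unity and [a] prime to
    [m].  If a small group on [k_{-1}] also contains an antidiagonal element
    [g], then [g] normalises the diagonal part, which gives [a^2 = 1 mod m], and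
    the coset of [g] produces all the products [bc x^(a+1)] with [x^m = 1], none
    of which is [-1].  Comparing [gcd(a+1,m)] with [gcd(a-1,m)] then forces
    [m = nk] with [n, k] coprime, [a = -1 mod n], [a = 1 mod k] and [k] not
    [2 mod 4], and allows one to choose [g] with [bc] of order exactly [k]. *)

Arguments tdim : simpl never.
Arguments tpow : simpl never.
Arguments Ideal : simpl never.

(** * Traces on quotient spaces, and tensor powers letter by letter *)

Section TraceOnQuotient.
Variable F : fieldType.

(** [Phi] is a quotient map with kernel [I] and section [Psi]. The projection [1 - Phi Psi] onto [I]
    factors as [C B] with [B C = 1], so the trace of [M] on [I] is [tr M - tr (M Phi Psi)], and the
    last term is [tr N]. *)
Lemma trace_quotient (p n : nat) (I M : 'M[F]_p) (Phi : 'M_(p, n))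
    (Psi : 'M_(n, p)) (N : 'M_n) :
    I *m Phi = 0 -> Psi *m Phi = 1%:M -> (1%:M - Phi *m Psi <= I)%MS ->
    M *m Phi = Phi *m N ->
  \tr M - \tr (row_base I *m M *m pinvmx (row_base I)) = \tr N.
Proof.
move=> IPhi PsiPhi QI MPhi; set B := row_base I.
have BPhi : B *m Phi = 0.
  have /submxP[X ->] : (B <= I)%MS by rewrite eq_row_base.
  by rewrite -mulmxA IPhi mulmx0.
have /submxP[C QE] : (1%:M - Phi *m Psi <= B)%MS by rewrite eq_row_base.
have BC : B *m C = 1%:M.
  have Bfree : row_free B by apply: row_base_free.
  apply: (row_free_inj Bfree).
  by rewrite mul1mx -mulmxA -QE mulmxBr mulmx1 mulmxA BPhi mul0mx subr0.
have /mulmxKpV BM : (B *m M <= B)%MS.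
  rewrite eq_row_base; apply: submx_trans QI; apply/submxP; exists (B *m M).
  by rewrite mulmxBr mulmx1 mulmxA -(mulmxA B) MPhi mulmxA BPhi !mul0mx subr0.
(* The rows of [B *m M] lie in the row space of [B], so any right inverse of [B] may replace
   [pinvmx B]. *)
have -> : B *m M *m pinvmx B = B *m M *m C.
  by rewrite -[X in _ = X *m C]BM -(mulmxA _ B C) BC mulmx1.
have -> : N = Psi *m M *m Phi.
  by rewrite -mulmxA MPhi mulmxA PsiPhi mul1mx.
have -> : \tr (B *m M *m C) = \tr (M *m (C *m B)).
  by rewrite -mulmxA mxtrace_mulC -mulmxA.
rewrite -QE mulmxBr mulmx1 linearB /= opprB addrC subrK.
by rewrite mulmxA mxtrace_mulC mulmxA.
Qed.

Lemma ord2P (i : 'I_2) : i = lu \/ i = lv.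
Proof. by case: i => [[|[|//]]] lti; [left | right]; apply: val_inj. Qed.

Lemma tensorP (m : nat) (x : 'rV[F]_(tdim m.+1)) :
  exists y : 'rV[F]_(tdim m), exists z, x = lt lu y + lt lv z.
Proof.
exists (row 0 (vec_mx x)); exists (row 1 (vec_mx x)).
apply: (can_inj (@vec_mxK _ _ _)).
rewrite /lt linearD /= !mxvecK; apply/matrixP => i j.
rewrite !mxE !big_ord1 !mxE /lu /lv.
by case: (ord2P i) => ->; rewrite /= ?mul1r ?mul0r ?addr0 ?add0r.
Qed.

Lemma lt_is_linear (m : nat) l : linear (@lt F m l).
Proof. by move=> a x y; rewrite /lt linearP /= linearP. Qed.
HB.instance Definition _ m l :=
  GRing.isLinear.Build F _ _ _ (@lt F m l) (@lt_is_linear m l).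

Lemma rtens_is_linear r m : linear (@rtens F r m).
Proof.
move=> a x y; rewrite /rtens -linearP /=; congr mxvec.
by apply/matrixP=> i j; rewrite !mxE mulmxDr -scalemxAr linearP !mxE.
Qed.
HB.instance Definition _ r m :=
  GRing.isLinear.Build F _ _ _ (@rtens F r m) (@rtens_is_linear r m).

Lemma row_delta_mul n (i l : 'I_2) (z : 'rV[F]_n) :
  row i (delta_mx l (0 : 'I_1) *m z) = if i == l then z else 0.
Proof.
rewrite row_mul rowE mul_delta_mx_cond; case: eqP => _; last by rewrite mul0mx.
by rewrite mulr1n [delta_mx _ _]mx11_scalar mxE !eqxx mul1mx.
Qed.

Lemma rtens_lt l l' m (y : 'rV[F]_(tdim m)) :
  rtens (lt l (lt l' (one0 F))) y = lt l (lt l' y).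
Proof.
rewrite /rtens [in RHS]/lt; congr mxvec; apply/row_matrixP => i.
rewrite rowK {1}/lt mxvecK !row_delta_mul; case: eqP => _.
  by rewrite /lt mxvecK /one0 mulmx1.
by rewrite linear0 mul0mx linear0.
Qed.

(** The map inside [tpow], named so that it can carry a linear structure. *)
Definition kronecker_map m (M : 'M[F]_2) (N : 'M[F]_(tdim m)) x
  : 'rV[F]_(tdim m.+1) := mxvec (M^T *m vec_mx x *m N).

Lemma kronecker_map_is_linear m M N : linear (@kronecker_map m M N).
Proof.
by move=> a x z; rewrite /kronecker_map !linearP /= mulmxDl -scalemxAl !linearP.
Qed.
HB.instance Definition _ m M N :=
  GRing.isLinear.Build F _ _ _ (@kronecker_map m M N)
    (@kronecker_map_is_linear m M N).

Lemma lt_tpow (M : 'M[F]_2) m l (y : 'rV[F]_(tdim m)) :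
  lt l y *m tpow M m.+1 =
  M l lu *: lt lu (y *m tpow M m) + M l lv *: lt lv (y *m tpow M m).
Proof.
rewrite [tpow M m.+1]/(lin1_mx (kronecker_map M (tpow M m))).
rewrite mul_rV_lin1 /= /kronecker_map /lt mxvecK.
have -> : M^T *m (delta_mx l (0 : 'I_1) *m y) =
    M l lu *: (delta_mx lu 0 *m y) + M l lv *: (delta_mx lv 0 *m y).
  rewrite mulmxA !scalemxAl -mulmxDl; congr (_ *m y).
  apply/matrixP=> i j; rewrite !mxE (bigD1 l) //= big1 => [|k kl].
    rewrite !mxE eqxx ord1 eqxx /= mulr1 addr0 !andbT.
    by case: (ord2P i) => ->; rewrite /= ?mulr0 ?mulr1 ?addr0 ?add0r.
  by rewrite !mxE (negbTE kl) mulr0.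
by rewrite mulmxDl -!scalemxAl linearD !linearZ /= !mulmxA.
Qed.

End TraceOnQuotient.

(** * The basis [u^i v^(m-i)] of the degree-m part of [A] *)

Section NormalForm.
Variable F : fieldType.
Variable A : alg F.

(* The relation of [A] is [vu = c uv + d uu]. *)
Definition rel_uv : F := if A is Kq q then q else 1.
Definition rel_uu : F := if A is Kq _ then 0 else 1.
Local Notation c := rel_uv.
Local Notation d := rel_uu.

Lemma relE : Defs.rel A = lt lv (lt lu (one0 F)) - c *: lt lu (lt lv (one0 F))
                     - d *: lt lu (lt lu (one0 F)).
Proof. by rewrite /rel_uv /rel_uu; case: A => [q|]; rewrite ?scale0r ?scale1r ?subr0. Qed.

Lemma rtens_rel m (y : 'rV[F]_(tdim m)) :
  rtens (Defs.rel A) y = lt lv (lt lu y) - c *: lt lu (lt lv y) - d *: lt lu (lt lu y).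
Proof.
have rtensl a r s : rtens (r - a *: s) y = rtens r y - a *: rtens s y.
  rewrite /rtens -linearZ -linearB /=; congr mxvec; apply/row_matrixP => i.
  rewrite rowK [RHS]linearB [in RHS]linearZ /= !rowK.
  have -> : vec_mx (row i (vec_mx (r - a *: s))) =
      vec_mx (row i (vec_mx r)) - a *: vec_mx (row i (vec_mx s)).
    by rewrite linearB linearB linearB !linearZ.
  by rewrite mulmxBl -scalemxAl linearB linearZ.
by rewrite relE !rtensl !rtens_lt.
Qed.

Lemma IdealSS m : Ideal (Defs.rel A) m.+2 =
  (Ideal (Defs.rel A) m.+1 *m lin1_mx (@lt F m.+1 lu) +
   Ideal (Defs.rel A) m.+1 *m lin1_mx (@lt F m.+1 lv) +
   lin1_mx (@rtens F (Defs.rel A) m))%MS.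
Proof. by []. Qed.

Lemma lt_Ideal m l (y : 'rV[F]_(tdim m)) :
  (y <= Ideal (Defs.rel A) m)%MS -> (lt l y <= Ideal (Defs.rel A) m.+1)%MS.
Proof.
case: m y => [|m] y yI.
  have -> : y = 0 by apply/eqP; rewrite -submx0.
  by rewrite linear0 sub0mx.
rewrite IdealSS -(mul_rV_lin1 (@lt F m.+1 l)).
case: (ord2P l) => ->.
  by apply: submx_trans (submxMr _ yI) _; rewrite -addsmxA addsmxSl.
apply: submx_trans (submxMr _ yI) _.
by rewrite (addsmxC (_ *m _) (_ *m _)) -addsmxA addsmxSl.
Qed.

Lemma rel_Ideal m (y : 'rV[F]_(tdim m)) :
  (rtens (Defs.rel A) y <= Ideal (Defs.rel A) m.+2)%MS.
Proof.
by rewrite -(mul_rV_lin1 (@rtens F (Defs.rel A) m)) /= (submx_trans _ (addsmxSr _ _)) ?submxMl.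
Qed.

(** Indexed by a natural number to avoid casts between ordinals; it is zero for [i > m]. It stands
    for the word [u^i v^(m-i)]. *)
Definition evec m (i : nat) : 'rV[F]_m.+1 := \row_j (j == i :> nat)%:R.

Lemma evec_mul m n (B : 'M[F]_(m.+1, n)) (i : 'I_m.+1) : evec m i *m B = row i B.
Proof.
rewrite rowE; congr (_ *m _); apply/rowP => j.
by rewrite !mxE eqxx.
Qed.

Lemma evec_mxP m n (B C : 'M[F]_(m.+1, n)) :
  (forall i, (i <= m)%N -> evec m i *m B = evec m i *m C) -> B = C.
Proof. by move=> eqBC; apply/row_matrixP => i; rewrite -!evec_mul eqBC // -ltnS. Qed.

(* [v u^i = c^i u^i v + move_coef i u^(i+1)] in [A]. *)
Fixpoint move_coef i : F := if i is j.+1 then c * move_coef j + d else 0.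

(** [Lu] and [Lv] are left multiplication by u and v on normal forms, from degree m to degree
    m+1. *)
Definition Lu m : 'M[F]_(m.+1, m.+2) := \matrix_i evec m.+1 i.+1.
Definition Lv m : 'M[F]_(m.+1, m.+2) :=
  \matrix_i (c ^+ i *: evec m.+1 i + move_coef i *: evec m.+1 i.+1).

Lemma evec_Lu m i : (i <= m)%N -> evec m i *m Lu m = evec m.+1 i.+1.
Proof. by rewrite -ltnS => im; rewrite (evec_mul _ (Ordinal im)) rowK. Qed.

Lemma evec_Lv m i : (i <= m)%N ->
  evec m i *m Lv m = c ^+ i *: evec m.+1 i + move_coef i *: evec m.+1 i.+1.
Proof. by rewrite -ltnS => im; rewrite (evec_mul _ (Ordinal im)) rowK. Qed.

(** The normal forms thus carry an [A]-module structure; this is what makes them linearly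
    independent in [A]. With row vectors, [Lu] followed by [Lv] is the action of [vu]. *)
Lemma Lrel m : Lu m *m Lv m.+1 =
  c *: (Lv m *m Lu m.+1) + d *: (Lu m *m Lu m.+1).
Proof.
apply: evec_mxP => i im.
rewrite mulmxDr -!scalemxAr !mulmxA evec_Lu // evec_Lu // evec_Lv // evec_Lv //.
rewrite mulmxDl -!scalemxAl !evec_Lu ?(leqW im) // scalerDr !scalerA /=.
by rewrite -exprS -addrA -scalerDl.
Qed.

Definition Phi_step m (P : 'M[F]_(tdim m, m.+1)) (x : 'rV[F]_(tdim m.+1)) :
  'rV[F]_m.+2 :=
  row lu (vec_mx x) *m P *m Lu m + row lv (vec_mx x) *m P *m Lv m.

Lemma Phi_step_is_linear m P : linear (@Phi_step m P).
Proof.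
move=> a x y; rewrite /Phi_step !linearP /= !mulmxDl -!scalemxAl scalerDr.
by rewrite addrACA.
Qed.
HB.instance Definition _ m P :=
  GRing.isLinear.Build F _ _ _ (@Phi_step m P) (@Phi_step_is_linear m P).

(** The normal form of a tensor, obtained by letting its letters act on 1 through [Lu] and [Lv]. *)
Fixpoint Phi m : 'M[F]_(tdim m, m.+1) :=
  match m return 'M[F]_(tdim m, m.+1) with
  | 0 => 1%:M
  | m'.+1 => lin1_mx (Phi_step (Phi m'))
  end.

Lemma PhiS m : Phi m.+1 = lin1_mx (Phi_step (Phi m)).
Proof. by []. Qed.
Arguments Phi : simpl never.

Lemma lu_Phi m (y : 'rV[F]_(tdim m)) : lt lu y *m Phi m.+1 = y *m Phi m *m Lu m.
Proof.
rewrite PhiS mul_rV_lin1 /= /Phi_step /lt mxvecK !row_delta_mul /=.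
by rewrite !mul0mx addr0.
Qed.

Lemma lv_Phi m (y : 'rV[F]_(tdim m)) : lt lv y *m Phi m.+1 = y *m Phi m *m Lv m.
Proof.
rewrite PhiS mul_rV_lin1 /= /Phi_step /lt mxvecK !row_delta_mul /=.
by rewrite !mul0mx add0r.
Qed.

Lemma tensor_mxP m n (B C : 'M[F]_(tdim m.+1, n)) :
  (forall y : 'rV[F]_(tdim m), lt lu y *m B = lt lu y *m C) ->
  (forall y : 'rV[F]_(tdim m), lt lv y *m B = lt lv y *m C) -> B = C.
Proof.
move=> eu ev; apply/row_matrixP => i; rewrite !rowE.
by have [y [z ->]] := @tensorP F m (delta_mx 0 i); rewrite !mulmxDl eu ev.
Qed.

(** Induction along the recursion of [Ideal]: letters in front become [Lu] or [Lv], and the summand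
    starting with the relation is killed by [Lrel]. *)
Lemma Ideal_Phi m : Ideal (Defs.rel A) m *m Phi m = 0.
Proof.
elim: m => [|[|m] IH]; rewrite ?mul0mx //.
apply/eqP; rewrite -sub_kermx IdealSS !addsmx_sub !sub_kermx.
have IHr i : row i (Ideal (Defs.rel A) m.+1) *m Phi m.+1 = 0.
  by rewrite -row_mul IH row0.
rewrite -andbA; apply/and3P; split; apply/eqP/row_matrixP => i; rewrite row0 !row_mul.
- by rewrite (mul_rV_lin1 (@lt F m.+1 lu)) /= lu_Phi IHr mul0mx.
- by rewrite (mul_rV_lin1 (@lt F m.+1 lv)) /= lv_Phi IHr mul0mx.
rewrite rowE (mul_rV_lin1 (@rtens F (Defs.rel A) m)) /= rtens_rel.
rewrite !mulmxBl -!scalemxAl lv_Phi !lu_Phi lv_Phi -!mulmxA Lrel.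
by rewrite !mulmxDr -!scalemxAr [X in X - _ - _]addrC addrK subrr.
Qed.

(* [nform m i] is the word [u^i v^(m-i)]; it is junk for [i > m]. *)
Fixpoint nform m i : 'rV[F]_(tdim m) :=
  match m return 'rV[F]_(tdim m) with
  | 0 => one0 F
  | m'.+1 => if i is j.+1 then lt lu (nform m' j) else lt lv (nform m' 0)
  end.

Definition Psi m : 'M[F]_(m.+1, tdim m) := \matrix_i nform m i.

Lemma evec_Psi m i : (i <= m)%N -> evec m i *m Psi m = nform m i.
Proof. by rewrite -ltnS => im; rewrite (evec_mul _ (Ordinal im)) rowK. Qed.

Lemma Psi_Phi m : Psi m *m Phi m = 1%:M.
Proof.
apply: evec_mxP => i im; rewrite mulmxA evec_Psi // mulmx1.
elim: m i im => [|m IH] [|i] // im.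
- by rewrite /= mulmx1; apply/rowP => j; rewrite !mxE !ord1.
- by rewrite [nform _ _]/= lv_Phi IH // evec_Lv // scale1r scale0r addr0.
- by rewrite [nform _ _]/= lu_Phi IH // evec_Lu.
Qed.

(** Straightening [v u^i] modulo the ideal: rewrite the leading [vu] by the relation, then apply u
    to the induction hypothesis. *)
Lemma lv_nform m i : (i <= m)%N ->
  (lt lv (nform m i) - (c ^+ i *: nform m.+1 i + move_coef i *: nform m.+1 i.+1)
     <= Ideal (Defs.rel A) m.+1)%MS.
Proof.
elim: i m => [|i IH] m im.
  by rewrite scale1r scale0r addr0 /= subrr sub0mx.
case: m im => // m im.
have := addmx_sub (rel_Ideal (nform m i)) (scalemx_sub c (lt_Ideal lu (IH m im))).
congr (_ <= _)%MS; rewrite rtens_rel.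
rewrite [X in _ + c *: X]linearB [X in _ + c *: (_ - X)]linearD /=.
rewrite [X in _ + c *: (_ - (X + _))]linearZ [X in _ + c *: (_ - (_ + X))]linearZ /=.
rewrite scalerBr scalerDr !scalerA -exprS scalerDl.
rewrite [_ - _ - d *: _]addrAC addrA subrK -addrA -opprD; congr (_ - _).
by rewrite addrC addrA.
Qed.

(** The spanning half: every tensor agrees with its normal form modulo the ideal. [Psi_Phi] is the
    independence half. *)
Lemma Phi_Psi m : (1%:M - Phi m *m Psi m <= Ideal (Defs.rel A) m)%MS.
Proof.
suff P (y : 'rV[F]_(tdim m)) : (y - y *m Phi m *m Psi m <= Ideal (Defs.rel A) m)%MS.
  apply/row_subP => i; rewrite rowE mulmxBr mulmx1 mulmxA; exact: P.
elim: m y => [|m IH] y.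
  have -> : Psi 0 = 1%:M by apply/matrixP=> i j; rewrite !mxE !ord1.
  by rewrite !mulmx1 subrr sub0mx.
(* For either letter, the tail is first put in normal form by induction, so only [lt l] of a single
   normal word is left to check. *)
have step l (L : 'M_(m.+1, m.+2)) :
    (forall y, lt l y *m Phi m.+1 = y *m Phi m *m L) ->
    (forall i, (i <= m)%N -> 
      (lt l (nform m i) - evec m i *m L *m Psi m.+1 <= Ideal (Defs.rel A) m.+1)%MS) ->
    forall y, (lt l y - lt l y *m Phi m.+1 *m Psi m.+1 <= Ideal (Defs.rel A) m.+1)%MS.
  move=> LE Lnf z; have /(lt_Ideal l) := IH z.
  rewrite LE; set x := z *m _; move=> zx.
  rewrite -[lt l z](subrK (lt l (x *m Psi m))) -addrA -linearB.
  apply: addmx_sub => //.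
  rewrite [x]row_sum_delta.
  rewrite !mulmx_suml linear_sum -sumrB; apply: summx_sub => i _.
  rewrite -!scalemxAl linearZ /= -scalerBr; apply: scalemx_sub.
  have := Lnf i (ltn_ord i); congr (_ <= _)%MS.
  have -> : evec m i = delta_mx 0 i by apply/rowP => j; rewrite !mxE eqxx.
  by rewrite -[in RHS]rowE rowK.
have [y1 [y2 ->]] := @tensorP F m y.
rewrite !mulmxDl opprD addrACA; apply: addmx_sub.
  apply: step (@lu_Phi m) _ _ => i im.
  by rewrite evec_Lu // evec_Psi // subrr sub0mx.
apply: step (@lv_Phi m) _ _ => i im.
rewrite evec_Lv // mulmxDl -!scalemxAl !evec_Psi ?(leqW im) //.
exact: lv_nform.
Qed.

(** Removes the ideal from trace computations: any matrix on normal forms intertwined with [g] by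
    [Phi] will do. *)
Lemma trA_mxtrace g m (N : 'M_m.+1) :
  tpow g^T m *m Phi m = Phi m *m N -> trA A g m = \tr N.
Proof. exact: trace_quotient (Ideal_Phi m) (Psi_Phi m) (Phi_Psi m). Qed.

End NormalForm.

(** * Graded automorphisms as 2 by 2 matrices *)

Section TwoByTwo.
Variable F : fieldType.
Implicit Types g M : 'M[F]_2.

Lemma mx2E a b c d : ((@mx2 F a b c d lu lu = a) * (mx2 a b c d lu lv = b) *
  (mx2 a b c d lv lu = c) * (mx2 a b c d lv lv = d))%type.
Proof. by rewrite !mxE. Qed.

Lemma mx2_eta M : M = mx2 (M lu lu) (M lu lv) (M lv lu) (M lv lv).
Proof.
by apply/matrixP => i j; case: (ord2P i) => ->; case: (ord2P j) => ->; rewrite mx2E.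
Qed.

Lemma mx2_inj a b c d a' b' c' d' : @mx2 F a b c d = mx2 a' b' c' d' ->
  [/\ a = a', b = b', c = c' & d = d'].
Proof.
move=> e; have f i j := congr1 (fun M : 'M_2 => M i j) e.
by have := (f lu lu, f lu lv, f lv lu, f lv lv); rewrite !mx2E => -[[[-> ->] ->] ->].
Qed.

Lemma tr_mx2 a b c d : (@mx2 F a b c d)^T = mx2 a c b d.
Proof. by rewrite [LHS]mx2_eta !mxE. Qed.

Lemma mul_mx2 a b c d a' b' c' d' : @mx2 F a b c d *m mx2 a' b' c' d' =
  mx2 (a * a' + b * c') (a * b' + b * d') (c * a' + d * c') (c * b' + d * d').
Proof. by rewrite [LHS]mx2_eta !mxE !big_ord_recl !big_ord0 !mxE !addr0. Qed.

Lemma unit_mx2 a b c d : (@mx2 F a b c d \in unitmx) = (a * d - b * c != 0).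
Proof.
rewrite unitmxE unitfE (expand_det_row _ lu) !big_ord_recl big_ord0 /cofactor.
rewrite !det_mx11 !mxE /= expr0 expr1 addr0 mul1r.
by congr (_ != 0); ring.
Qed.

Lemma lt_inj2 m (y z y' z' : 'rV[F]_(tdim m)) :
  lt lu y + lt lv z = lt lu y' + lt lv z' -> y = y' /\ z = z'.
Proof.
move=> e; have f i := congr1 (fun x : 'rV[F]_(tdim m.+1) => row i (vec_mx x)) e.
have := (f lu, f lv).
by rewrite /lt !linearD /= !mxvecK !row_delta_mul /= !addr0 !add0r => -[].
Qed.

Lemma words2_inj (a b c d a' b' c' d' : F) :
  let uu := lt lu (lt lu (one0 F)) in let uv := lt lu (lt lv (one0 F)) in
  let vu := lt lv (lt lu (one0 F)) in let vv := lt lv (lt lv (one0 F)) in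
  a *: uu + b *: uv + c *: vu + d *: vv = a' *: uu + b' *: uv + c' *: vu + d' *: vv
  -> [/\ a = a', b = b', c = c' & d = d'].
Proof.
move=> uu uv vu vv; rewrite /uu /uv /vu /vv.
have Z m l x (y : 'rV[F]_(tdim m)) : x *: lt l y = lt l (x *: y) by rewrite linearZ.
have D m l (y z : 'rV[F]_(tdim m)) : lt l y + lt l z = lt l (y + z) by rewrite linearD.
rewrite !Z -!addrA !D !addrA !D => /lt_inj2[] /lt_inj2[e1 e2] /lt_inj2[e3 e4].
have f x y : x *: one0 F = y *: one0 F -> x = y.
  by move/matrixP/(_ 0 0); rewrite !mxE !mulr1.
by rewrite (f _ _ e1) (f _ _ e2) (f _ _ e3) (f _ _ e4).
Qed.

(** [k] is the scalar by which [g] multiplies the relation; the equations compare the coefficients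
    of uu, uv, vu and vv, in this order. *)
Lemma isAutE (A : alg F) a b c d (r := rel_uv A) (s := rel_uu A) :
  isAut A (mx2 a b c d) <-> a * d - b * c != 0 /\
   exists k, [/\ a * b * (1 - r) - s * a ^+ 2 = - s * k,
      b * c - r * a * d - s * a * c = - r * k,
      a * d - r * b * c - s * a * c = k &
      c * d * (1 - r) - s * c ^+ 2 = 0].
Proof.
rewrite /isAut unit_mx2 tr_mx2 relE -/r -/s.
set R := _ - _ - _.
have RM : R *m tpow (mx2 a c b d) 2 =
    (a * b * (1 - r) - s * a ^+ 2) *: lt lu (lt lu (one0 F)) +
    (b * c - r * a * d - s * a * c) *: lt lu (lt lv (one0 F)) +
    (a * d - r * b * c - s * a * c) *: lt lv (lt lu (one0 F)) +
    (c * d * (1 - r) - s * c ^+ 2) *: lt lv (lt lv (one0 F)).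
  rewrite /R !mulmxBl -!scalemxAl !lt_tpow !mx2E [tpow _ 0]/(1%:M) !mulmx1.
  rewrite !linearD !linearZ /=.
  set uu := lt lu (lt lu _); set uv := lt lu (lt lv _).
  set vu := lt lv (lt lu _); set vv := lt lv (lt lv _).
  by apply/rowP => i; rewrite !mxE; ring.
have RE k : k *: R = (- s * k) *: lt lu (lt lu (one0 F)) +
     (- r * k) *: lt lu (lt lv (one0 F)) +
    k *: lt lv (lt lu (one0 F)) + 0 *: lt lv (lt lv (one0 F)).
  rewrite /R; set uu := lt lu (lt lu _); set uv := lt lu (lt lv _).
  set vu := lt lv (lt lu _); set vv := lt lv (lt lv _).
  by apply/rowP => i; rewrite !mxE; ring.
split=> -[nz].
  by move/sub_rVP => [k]; rewrite RM RE => /words2_inj[? ? ? ?]; split=> //; exists k.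
move=> [k [e1 e2 e3 e4]]; split=> //; apply/sub_rVP; exists k.
by rewrite RM RE e1 e2 e3 e4.
Qed.

Lemma isAut_Kq_diag q x y : x != 0 -> y != 0 -> isAut (Kq q) (@mx2 F x 0 0 y).
Proof.
move=> x0 y0; apply/isAutE; split; first by rewrite mul0r subr0 mulf_neq0.
by exists (x * y); rewrite /=; split; ring.
Qed.

Lemma isAut_Kq_anti x y : x != 0 -> y != 0 -> isAut (Kq (-1)) (@mx2 F 0 x y 0).
Proof.
move=> x0 y0; apply/isAutE; split; first by rewrite mul0r sub0r oppr_eq0 mulf_neq0.
by exists (x * y); rewrite /=; split; ring.
Qed.

Lemma isAut_KJ_scalar x : x != 0 -> isAut KJ (@mx2 F x 0 0 x).
Proof.
move=> x0; apply/isAutE; split; first by rewrite mul0r subr0 mulf_neq0.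
by exists (x * x); rewrite /=; split; ring.
Qed.

(** The uu and vv coefficients give [ab = cd = 0]; eliminating [k] from the other two gives
    [bc(1 - q^2) = 0]. Invertibility then leaves the two shapes. *)
Lemma isAut_KqP q g : q != 1 -> isAut (Kq q) g ->
  (exists x y, [/\ x != 0, y != 0 & g = mx2 x 0 0 y]) \/
  (q = -1 /\ exists x y, [/\ x != 0, y != 0 & g = mx2 0 x y 0]).
Proof.
move=> q1; rewrite [g]mx2_eta; move: (g lu lu) (g lu lv) (g lv lu) (g lv lv).
move=> a b c d /isAutE[] /= nz [k [e1 e2 e3 e4]].
have q1' : 1 - q != 0 by rewrite subr_eq0 eq_sym.
have ab0 : (a == 0) || (b == 0).
  have /eqP : a * b * (1 - q) = 0.
    by transitivity (a * b * (1 - q) - 0 * a ^+ 2); [|rewrite e1]; ring.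
  by rewrite !mulf_eq0 (negbTE q1') orbF.
have cd0 : (c == 0) || (d == 0).
  have /eqP : c * d * (1 - q) = 0 by rewrite -e4; ring.
  by rewrite !mulf_eq0 (negbTE q1') orbF.
have bcq : b * c * (1 + q) = 0.
  apply: (mulIf q1'); rewrite mul0r; transitivity (b * c - q * a * d + q * (a * d - q * b * c)); first by ring.
  have -> : a * d - q * b * c = k by rewrite -e3; ring.
  have -> : b * c - q * a * d = - q * k by rewrite -e2; ring.
  by ring.
have [a0|a0] := eqVneq a 0.
  have bc0 : b * c != 0 by move: nz; rewrite a0 mul0r sub0r oppr_eq0.
  move: (bc0); rewrite mulf_eq0 negb_or => /andP[b0 c0].
  right; split; last first.
    by exists b, c; rewrite (eqP (_ : d == 0)) ?a0 //; move: cd0; rewrite (negbTE c0).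
  move/eqP: bcq; rewrite mulf_eq0 (negbTE bc0) /= addrC addr_eq0 => /eqP ->; by [].
have b0 : b = 0 by apply/eqP; move: ab0; rewrite (negbTE a0).
move: nz; rewrite b0 mul0r subr0 mulf_eq0 negb_or => /andP[_ d0].
left; exists a, d; split=> //.
by rewrite (eqP (_ : c == 0)) //; move: cd0; rewrite (negbTE d0) orbF.
Qed.

(** The coefficient of vv forces [c = 0], that of uu gives [k = a^2], and that of vu then gives
    [d = a]. *)
Lemma isAut_KJP g : isAut KJ g -> exists x b, x != 0 /\ g = mx2 x b 0 x.
Proof.
rewrite [g]mx2_eta; move: (g lu lu) (g lu lv) (g lv lu) (g lv lv).
move=> a b c d /isAutE[] /= nz [k [e1 e2 e3 e4]].
have c0 : c = 0.
  by apply/eqP; rewrite -[_ == _](expf_eq0 c 2) -oppr_eq0; apply/eqP; rewrite -e4; ring.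
have ka : k = a * a by apply: oppr_inj; rewrite -[LHS]mulN1r -e1; ring.
move: nz; rewrite c0 mulr0 subr0 mulf_eq0 negb_or => /andP[a0 d0].
exists a, b; split=> //; congr mx2; apply: (mulfI a0); rewrite -ka -e3 c0; ring.
Qed.

End TwoByTwo.

(** * Trace series and the quasi-reflection criteria *)

Section QuasiReflections.
Variable F : fieldType.

(** The equation at [m = 0] makes [T 0] nonzero, so the coefficients of an inverse are determined
    recursively. *)
Lemma inverse_series_uniq (T : nat -> F) (P Q : {poly F}) :
    (forall m : nat, \sum_(j < m.+1) P`_j * T (m - j)%N = (m == 0%N)%:R) ->
    (forall m : nat, \sum_(j < m.+1) Q`_j * T (m - j)%N = (m == 0%N)%:R) ->
  P = Q.
Proof.
move=> PT QT; apply/polyP => m.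
have T0 : T 0%N != 0.
  have := PT 0%N; rewrite big_ord1 subn0 => e; apply/eqP => T0.
  by move/eqP: e; rewrite T0 mulr0 eq_sym oner_eq0.
elim/ltn_ind: m => m IH.
have := etrans (PT m) (esym (QT m)); rewrite !big_ord_recr /= subnn.
rewrite (eq_bigr (fun j : 'I_m => Q`_j * T (m - j)%N)) => [/addrI|j _].
  exact: mulIf.
by rewrite IH.
Qed.

Lemma inverse_series_deg2 (T : nat -> F) (s r : F) :
    T 0%N = 1 -> T 1%N = s -> (forall m, T m.+2 = s * T m.+1 - r * T m) ->
  forall m, \sum_(j < m.+1) (1 - s *: 'X + r *: 'X^2)`_j * T (m - j)%N = (m == 0%N)%:R.
Proof.
move=> T0 T1 TS m.
have coefs j : (1 - s *: 'X + r *: 'X^2)`_j =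
    (j == 0%N)%:R - s * (j == 1%N)%:R + r * (j == 2%N)%:R.
  by rewrite !coefE.
case: m => [|[|m]]; rewrite ?big_ord_recl ?big_ord0 !coefs /= ?subn0 ?T0 ?T1; [ring|ring|].
rewrite big1 => [|j _]; last by rewrite coefs /=; ring.
by rewrite /= /bump /= ?addn0 ?subn0 !subSS ?subn0 TS; ring.
Qed.

(** The recurrence says that the trace series is [1/(1 - st + rt^2)]; by uniqueness of the inverse,
    being a quasi-reflection becomes a factorisation of that denominator. *)
Lemma quasi_reflectionE A g (s r : F) :
    trA A g 0 = 1 -> trA A g 1 = s ->
    (forall m, trA A g m.+2 = s * trA A g m.+1 - r * trA A g m) ->
  quasi_reflection A g <->
    exists p : {poly F}, p.[1] != 0 /\ (1 - 'X) * p = 1 - s *: 'X + r *: 'X^2.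
Proof.
move=> T0 T1 TS; have conv := inverse_series_deg2 T0 T1 TS.
split=> -[p [p1 pE]]; exists p; split=> //; last by move=> m; rewrite pE conv.
exact: inverse_series_uniq pE conv.
Qed.

(** The complete homogeneous symmetric polynomial, the coefficient of [t^m] in
    [1/((1-xt)(1-yt))]. *)
Definition dtr (x y : F) m := \sum_(i < m.+1) x ^+ i * y ^+ (m - i).

Lemma dtrS x y m : dtr x y m.+1 = y * dtr x y m + x ^+ m.+1.
Proof.
rewrite /dtr big_ord_recr /= subnn expr0 mulr1; congr (_ + _).
rewrite mulr_sumr; apply: eq_bigr => i _.
by rewrite subSn ?exprS 1?mulrCA // -ltnS.
Qed.

(** Each [u^i v^(m-i)] is an eigenvector with eigenvalue [x^i y^(m-i)]. The hypothesis makes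
    [diag(x, y)] compatible with the uu term of the relation. *)
Lemma trA_diag A (x y : F) m : rel_uu A = 0 \/ x = y ->
  trA A (mx2 x 0 0 y) m = dtr x y m.
Proof.
move=> xy.
pose N m : 'M[F]_m.+1 := \matrix_i (x ^+ i * y ^+ (m - i) *: evec F m i).
have NE n i : (i <= n)%N -> evec F n i *m N n = x ^+ i * y ^+ (n - i) *: evec F n i.
  by rewrite -ltnS => im; rewrite (evec_mul _ (Ordinal im)) rowK.
have NLu n : x *: (N n *m Lu F n) = Lu F n *m N n.+1.
  apply: evec_mxP => i im; rewrite -!scalemxAr !mulmxA NE // -!scalemxAl evec_Lu //.
  by rewrite NE // scalerA mulrA -exprS subSS.
have mc i : x * move_coef A i = y * move_coef A i.
  case: xy => [d0|-> //]; suff -> : move_coef A i = 0 by rewrite !mulr0.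
  by elim: i => //= i ->; rewrite mulr0 d0 addr0.
have NLv n : y *: (N n *m Lv A n) = Lv A n *m N n.+1.
  apply: evec_mxP => i im; rewrite -!scalemxAr !mulmxA NE // -!scalemxAl evec_Lv //.
  rewrite mulmxDl -!scalemxAl !NE ?(leqW im) // !scalerDr !scalerA; congr (_ *: _ + _ *: _).
    by rewrite (subSn im) exprS; ring.
  rewrite subSS exprS; transitivity (x ^+ i * y ^+ (n - i) * (y * move_coef A i)); first by ring.
  by rewrite -mc; ring.
rewrite (trA_mxtrace (N := N m)).
  by apply: eq_bigr => i _; rewrite !mxE eqxx mulr1.
rewrite tr_mx2; elim: m => [|m IH].
  suff -> : N 0%N = 1%:M by rewrite [tpow _ _]/(1%:M) mul1mx ?mulmx1.
  apply/matrixP => i j; rewrite !mxE !ord1 eqxx.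
  by rewrite !mulr1.
apply: tensor_mxP => z; rewrite !mulmxA lt_tpow !mx2E ?scale0r ?addr0 ?add0r -scalemxAl.
  by rewrite !lu_Phi -[_ *m Phi A m]mulmxA IH !mulmxA -[RHS]mulmxA -NLu -scalemxAr !mulmxA.
by rewrite !lv_Phi -[_ *m Phi A m]mulmxA IH !mulmxA -[RHS]mulmxA -NLv -scalemxAr !mulmxA.
Qed.

(** [u^i v^(m-i)] goes to a multiple of [u^(m-i) v^i], the sign coming from reordering
    [v^i u^(m-i)]. Only the middle word, present for even m, contributes to the trace. *)
Lemma trA_anti (b c : F) m :
  trA (Kq (-1)) (mx2 0 b c 0) m = if odd m then 0 else (- (b * c)) ^+ m./2.
Proof.
pose A := Kq (-1 : F).
pose a m i : F := c ^+ i * b ^+ (m - i) * (-1) ^+ (i * (m - i)).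
pose N m : 'M[F]_m.+1 := \matrix_i (a m i *: evec F m (m - i)).
have NE n i : (i <= n)%N -> evec F n i *m N n = a n i *: evec F n (n - i).
  by rewrite -ltnS => im; rewrite (evec_mul _ (Ordinal im)) rowK.
have mc i : move_coef A i = 0 by elim: i => //= i ->; rewrite mulr0 addr0.
have sgn n : (-1) ^+ n * (-1) ^+ n = 1 :> F by rewrite -exprMn mulrNN mulr1 expr1n.
have NLu n : c *: (N n *m Lv A n) = Lu F n *m N n.+1.
  apply: evec_mxP => i im; rewrite -!scalemxAr !mulmxA NE // -!scalemxAl evec_Lu //.
  rewrite evec_Lv ?leq_subr // mc scale0r addr0 NE // !scalerA subSS; congr (_ *: _).
  by rewrite /a subSS mulSn exprD exprS /rel_uv /A; ring.
have NLv n : b *: (N n *m Lu F n) = Lv A n *m N n.+1.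
  apply: evec_mxP => i im; rewrite -!scalemxAr !mulmxA NE // -!scalemxAl evec_Lv //.
  rewrite evec_Lu ?leq_subr // mc scale0r addr0 -scalemxAl NE ?(leqW im) // !scalerA.
  rewrite subSn //; congr (_ *: _).
  rewrite /a subSn // mulnS exprD exprS /rel_uv /A.
  by rewrite -[LHS]mul1r -[X in X * _ = _](sgn i); ring.
rewrite (trA_mxtrace (N := N m)).
  have -> : \tr (N m) = \sum_(i < m.+1 | i == (m - i)%N :> nat) a m i.
    rewrite [RHS]big_mkcond; apply: eq_bigr => i _.
    by rewrite !mxE; case: eqP => _; rewrite ?mulr1 ?mulr0.
  case: ifP => om.
    by rewrite big1 // => i /eqP e; have := ltn_ord i; lia.
  have mE : (m./2 + m./2)%N = m by rewrite addnn -[RHS]odd_double_half om.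
  have hm : (m./2 < m.+1)%N by lia.
  rewrite (big_pred1 (Ordinal hm)) => [|i]; last first.
    by apply/eqP/eqP => [e|->]; [apply: val_inj => /=; lia | rewrite /=; lia].
  rewrite /a /= -[X in (X - _)%N]mE addnK -signr_odd oddM andbb signr_odd.
  by rewrite -!exprMn; congr (_ ^+ _); ring.
rewrite tr_mx2; elim: m => [|m IH].
  suff -> : N 0%N = 1%:M by rewrite [tpow _ _]/(1%:M) mul1mx ?mulmx1.
  apply/matrixP => i j; rewrite !mxE !ord1 eqxx.
  by rewrite /a !mulr1.
apply: tensor_mxP => z; rewrite !mulmxA lt_tpow !mx2E ?scale0r ?addr0 ?add0r -scalemxAl.
  by rewrite lu_Phi lv_Phi -[_ *m Phi A m]mulmxA IH !mulmxA -[RHS]mulmxA -NLu -scalemxAr !mulmxA.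
by rewrite lu_Phi lv_Phi -[_ *m Phi A m]mulmxA IH !mulmxA -[RHS]mulmxA -NLv -scalemxAr !mulmxA.
Qed.

(** Evaluating the denominator [(1-xt)(1-yt)] at 1 forces [x] or [y] to be 1; after cancelling
    [1-t], [p(1) != 0] says that the other is not 1. *)
Lemma quasi_reflection_diag A (x y : F) : rel_uu A = 0 \/ x = y ->
  quasi_reflection A (mx2 x 0 0 y) <-> (x == 1) (+) (y == 1).
Proof.
move=> xy; rewrite (@quasi_reflectionE _ _ (x + y) (x * y)); first last.
- by move=> m; rewrite !trA_diag // !dtrS !exprS; ring.
- by rewrite trA_diag // dtrS /dtr big_ord1 expr0 expr1 addrC !mulr1.
- by rewrite trA_diag // /dtr big_ord1 mulr1.
have -> : 1 - (x + y) *: 'X + (x * y) *: 'X^2 = (1 - x *: 'X) * (1 - y *: 'X) :> {poly F}.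
  by rewrite -!mul_polyC !rmorphD rmorphM /=; ring.
have nX : 1 - 'X != 0 :> {poly F}.
  by apply/eqP => /(congr1 (fun p : {poly F} => p.[0])); rewrite !hornerE subr0; apply/eqP/oner_neq0.
split=> [[p [p1 pE]]|].
  have := congr1 (fun p : {poly F} => p.[1]) pE; rewrite !hornerE subrr mul0r => /esym/eqP.
  rewrite mulf_eq0 !subr_eq0 ![1 == _]eq_sym.
  have [x1|x1] /= := eqVneq x 1; last first.
    by move=> ->.
  move: pE; rewrite x1 scale1r => /(mulfI nX) pE _.
  by move: p1; rewrite pE !hornerE subr_eq0 eq_sym.
case: (eqVneq x 1) => [->|x1] /= => [y1|/eqP->].
  exists (1 - y *: 'X); rewrite !hornerE subr_eq0 eq_sym scale1r; split=> //.
exists (1 - x *: 'X); rewrite !hornerE subr_eq0 eq_sym scale1r mulrC; split=> //.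
Qed.

(** [1 + bc t^2] vanishes at 1 exactly when [bc = -1]; then [p = 1 + t], with [p(1) = 2]. *)
Lemma quasi_reflection_anti (b c : F) : 2%:R != 0 :> F ->
  quasi_reflection (Kq (-1)) (mx2 0 b c 0) <-> b * c = -1.
Proof.
move=> two; rewrite (@quasi_reflectionE _ _ 0 (b * c)); first last.
- by move=> m; rewrite !trA_anti /= negbK; case: ifP => _; rewrite ?exprS; ring.
- by rewrite trA_anti.
- by rewrite trA_anti.
rewrite scale0r subr0; split=> [[p [p1 pE]]|->].
  have := congr1 (fun p : {poly F} => p.[1]) pE.
  by rewrite !hornerE /= subrr mul0r !mulr1 => /esym/eqP; rewrite addrC addr_eq0 => /eqP.
exists (1 + 'X); rewrite !hornerE; split; first exact: two.
by rewrite scaleN1r; ring.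
Qed.

End QuasiReflections.

(** * Splitting the order of the diagonal part as [n k] *)

Section NumberTheory.
Local Open Scope nat_scope.

Lemma dvdn_gcdM m x y : m %| x * y -> m %| gcdn x m * gcdn y m.
Proof.
move=> mxy; rewrite muln_gcdr !muln_gcdl !dvdn_gcd mxy.
by rewrite /= !(dvdn_mulr _ (dvdnn m)) dvdn_mull.
Qed.

Lemma evenE x : ~~ odd x -> exists y, x = y * 2.
Proof. by move=> ex; exists x./2; rewrite muln2 -[LHS]odd_double_half (negbTE ex). Qed.

Lemma oddE x : odd x -> exists y, x = (y * 2).+1.
Proof. by move=> ox; exists x./2; rewrite muln2 -[LHS]odd_double_half ox. Qed.

(** For the diagonal part [<diag(w, w^a)>] of order m and an antidiagonal element with [bc = w^e],
    the numbers [e + (a+1)j] are the exponents of the products of entries over the antidiagonal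
    coset. The exponent [m/2] would give -1, a quasi-reflection. *)
Lemma split_modulus (m a e : nat) : 0 < m -> 0 < a ->
    a * a = 1 %[mod m] -> e * a = e %[mod m] ->
    (~~ odd m -> forall j, e + a.+1 * j <> m./2 %[mod m]) ->
  exists n k j, [/\ n * k = m, coprime n k, n %| a.+1 & k %| a.-1] /\
    (k %% 4 != 2) /\ e + a.+1 * j = n %[mod m].
Proof.
(* From here on [a.+2] and [a] are the original [a+1] and [a-1]. *)
move=> m0; case: a => // a _ aa ea half.
have maa : m %| a.+2 * a.
  have /eqP := aa; rewrite eqn_mod_dvd; last by lia.
  by congr (_ %| _); lia.
have mea : m %| e * a.
  have /eqP := ea; rewrite eqn_mod_dvd; last by lia.
  by congr (_ %| _); lia.
set d := gcdn a.+2 m; set d' := gcdn a m.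
have dm : d %| m by apply: dvdn_gcdr.
have d'm : d' %| m by apply: dvdn_gcdr.
have da : d %| a.+2 by apply: dvdn_gcdl.
have d'a : d' %| a by apply: dvdn_gcdl.
have mdd : m %| d * d' by apply: dvdn_gcdM.
have med : m %| e * d' by rewrite muln_gcdr dvdn_gcd mea dvdn_mull.
have g2 : gcdn d d' %| 2.
  have ga : gcdn d d' %| a by apply: dvdn_trans d'a; apply: dvdn_gcdr.
  by rewrite -(dvdn_addr _ ga) addn2; apply: dvdn_trans da; apply: dvdn_gcdl.
have d0 : 0 < d by rewrite gcdn_gt0.
have d'0 : 0 < d' by rewrite gcdn_gt0 m0 orbT.
(* Modulo [m], the multiples of [a+1] are the multiples of [d]. *)
have reach t s c : e + d * s = t + c * m -> exists j, e + a.+2 * j = t %[mod m].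
  have [km kn E _] := @egcdnP a.+2 m isT.
  move=> es; exists (km * s).
  have -> : e + a.+2 * (km * s) = (kn * s + c) * m + t.
    rewrite mulnA [_ * km]mulnC E mulnDl addnCA es /d; lia.
  by rewrite modnMDl.
have dd2 : ~~ odd m -> (2 %| d) && (2 %| d').
  move=> em; have ea2 : ~~ odd a.
    have /dvdnP[z zE] := maa; have : odd (a.+2 * a) = odd (z * m) by rewrite zE.
    by rewrite !oddM /= (negbTE em) andbF negbK andbb => ->.
  by rewrite !dvdn_gcd !dvdn2 em /= negbK ea2.
clearbody d d'.
have [om|em] := boolP (odd m).
  have cop : coprime d d'.
    have : gcdn d d' %| m by rewrite (dvdn_trans (dvdn_gcdl _ _)).
    move=> /dvdnP[z zE]; move: om; rewrite zE oddM => /andP[_ og].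
    by rewrite /coprime; move: (dvdn_leq (ltn0Sn 1) g2) og {zE}; case: gcdn => [|[|[|]]].
  have mE : m = d * d'.
    by apply/eqP; rewrite eqn_dvd mdd Gauss_dvd // dm d'm.
  have /dvdnP[x eE] : d %| e.
    by rewrite -(@dvdn_pmul2r d') // -mE.
  have [j jE] : exists j, e + a.+2 * j = d %[mod m].
    (* The multiplier wanted is [1 - x] modulo [d']; [x * d'.-1] replaces [-x]. The same device
       recurs below. *)
    by apply: (reach d (1 + x * d'.-1) x); rewrite eE mE; case: (d') d'0 => // d'' _ /=; ring.
  exists d, d', j; split; split => //.
  by move: om; rewrite mE oddM => /andP[_]; clear; lia.
have /andP[/dvdnP[D dE] /dvdnP[D' d'E]] := dd2 em.
subst d d'; move: g2 d0 d'0; rewrite -muln_gcdl => g2 d0 d'0.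
have cop : coprime D D'.
  by move: g2; rewrite -[X in _ %| X]mul1n dvdn_pmul2r // dvdn1.
have D0 : 0 < D by move: d0; rewrite muln_gt0 => /andP[].
have D'0 : 0 < D' by move: d'0; rewrite muln_gt0 => /andP[].
have [M mM] := evenE em.
have /dvdnP[z zE] : D * D' %| M.
  by rewrite Gauss_dvd //; move: dm d'm; rewrite mM !dvdn_pmul2r // => -> ->.
(* [m] is [d d' / 2] or [d d']; in the latter case [m/2] is reached from [e]. *)
have z12 : z = 1 \/ z = 2.
  have : z %| 2.
    rewrite -(@dvdn_pmul2r (D * D' * 2)) ?muln_gt0 ?D0 ?D'0 //.
    by move: mdd; rewrite mM zE; congr (_ %| _); ring.
  by move=> z2; have := dvdn_leq (ltn0Sn 1) z2; move: z2; case: z {zE} => [|[|[|?]]] //; [left|right].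
have halfE : m./2 = M by rewrite mM muln2 doubleK.
move: half; rewrite halfE => half.
(* When [m = d d'], [e] is a multiple of [d], as is [m/2], so [m/2] is reached and this case is
   excluded. *)
case: z12 => z12; subst z; last first.
  have /dvdnP[x eE] : D * 2 %| e.
    rewrite -(@dvdn_pmul2r (D' * 2)) //; move: med.
    by rewrite mM zE; congr (_ %| _); ring.
  have [j jE] : exists j, e + a.+2 * j = M %[mod m].
    apply: (reach M (D' + x * (D' * 2).-1) x); rewrite eE mM zE.
    by case: (D') D'0 => // k _ /=; ring.
  by case: (half em j).
rewrite mul1n in zE.
have /dvdnP[x eE] : D %| e.
  rewrite -(@dvdn_pmul2r (D' * 2)) //; move: med.
  by rewrite mM zE; congr (_ %| _); ring.
(* Now [m = 2DD'], [e = xD] and [m/2 = DD'], so [m/2] is reached when [x] and [D'] have the same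
   parity. The other two cases give [(n, k) = (2D, D')] for [D'] odd and [(D, 2D')] for [D']
   even. *)
have [ox|ex] := boolP (odd x); last first.
  have [y xE] := evenE ex.
  have [oD|eD] := boolP (odd D'); last first.
    have [w wE] := evenE eD.
    have [j jE] : exists j, e + a.+2 * j = M %[mod m].
      apply: (reach M (w + y * D'.-1) y); rewrite eE mM zE xE.
      by rewrite wE; case: (w) wE D'0 => [-> //|k _ _ /=]; ring.
    by case: (half em j).
  have [j jE] : exists j, e + a.+2 * j = D * 2 %[mod m].
    by apply: (reach (D * 2) (1 + y * D'.-1) y); rewrite eE mM zE xE; case: (D') D'0 => // k _ /=; ring.
  exists (D * 2), D', j; split; split=> //.
  - by rewrite mM zE; ring.
  - by rewrite coprimeMl cop coprime2n.
  - by rewrite /= (dvdn_trans _ d'a) // dvdn_mulr.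
  - by move: oD; clear; lia.
have [y xE] := oddE ox.
have [oD|eD] := boolP (odd D').
  have [w wE] := oddE oD.
  have [j jE] : exists j, e + a.+2 * j = M %[mod m].
    by apply: (reach M (w + y * D'.-1) y); rewrite eE mM zE xE wE /=; ring.
  by case: (half em j).
have oD : odd D.
  apply/negPn/negP => eD2; move: cop; rewrite /coprime => /eqP cop.
  have : 2 %| gcdn D D' by rewrite dvdn_gcd !dvdn2 eD2 eD.
  by rewrite cop.
have [j jE] : exists j, e + a.+2 * j = D %[mod m].
  by apply: (reach D (y * D'.-1) y); rewrite eE mM zE xE; case: (D') D'0 => // k _ /=; ring.
exists D, (D' * 2), j; split; split=> //.
- by rewrite mM zE; ring.
- by rewrite coprimeMr cop coprimen2.
- by rewrite (dvdn_trans _ da) // dvdn_mulr.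
- by move: eD; clear; lia.
Qed.
End NumberTheory.

(** * Finite multiplicative sets and primitive roots of unity *)

Section RootsOfUnity.

(** Multiplication by [x] permutes the finite set, so comparing the products of all elements gives
    [x ^+ size U = 1]; a full set of roots of unity contains a primitive one. *)
Lemma finite_mul_cyclic (F : fieldType) (S : seq F) : 1 \in S ->
    {in S, forall x, x != 0} -> {in S &, forall x y, x * y \in S} ->
  exists n w, [/\ n.-primitive_root w, w \in S &
    {in S, forall x, exists i, x = w ^+ i}].
Proof.
move=> S1 S0 SM; pose U := undup S.
have U1 : 1 \in U by rewrite mem_undup.
have n0 : (0 < size U)%N by case: (U) U1.
have Un x : x \in U -> x ^+ size U = 1.
  rewrite mem_undup => xS.
  have permU : perm_eq [seq x * y | y <- U] U.
    have uxU : uniq [seq x * y | y <- U].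
      by rewrite map_inj_uniq ?undup_uniq //; apply/mulfI/S0.
    have sub : {subset [seq x * y | y <- U] <= U}.
      by move=> _ /mapP[y yU ->]; rewrite mem_undup SM // -mem_undup.
    apply: uniq_perm; rewrite ?undup_uniq //.
    by have [] := uniq_min_size uxU sub; rewrite ?size_map.
  have prodU : \prod_(y <- U) y != 0.
    by rewrite prodf_seq_neq0; apply/allP => y; rewrite mem_undup => /S0.
  apply: (mulIf prodU); rewrite mul1r -[RHS](perm_big _ permU) /= big_map.
  by rewrite big_split /= big_const_seq count_predT iter_mulr_1.
have /hasP[w wU wP] : has (size U).-primitive_root U.
  apply: has_prim_root => //; last exact: undup_uniq.
  by apply/allP => x /Un xn; apply/unity_rootP.
exists (size U), w; split=> //; first by rewrite -mem_undup.
move=> x; rewrite -mem_undup => /Un xn.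
by have [i ->] := prim_rootP wP xn; exists i.
Qed.

Variable F : closedFieldType.
Hypothesis two : 2%:R != 0 :> F.

Lemma oppr1_neq1 : -1 != 1 :> F.
Proof. by rewrite eq_sym -subr_eq0 opprK. Qed.

(** Some square root [y] has [y^m = -1]: if [y0^m = 1], then m is odd, since otherwise
    [x^(m/2) = 1], and [-y0] works. The order of [y] is a multiple of m dividing 2m, and it is not
    m. *)
Lemma sqrt_prim_root m (x : F) : m.-primitive_root x ->
  exists y, y ^+ 2 = x /\ (2 * m).-primitive_root y.
Proof.
move=> xm; have m0 := prim_order_gt0 xm.
have [y0 y0E] : exists y, y ^+ 2 = x.
  have [|y] := @solve_monicpoly F 2 (fun i => if i == 0%N then x else 0); first by [].
  by rewrite !big_ord_recl big_ord0 /= mulr1 mul0r !addr0 => <-; exists y.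
have [y [yE ym]] : exists y, y ^+ 2 = x /\ y ^+ m = -1.
  have : (y0 ^+ m) ^+ 2 == 1 by rewrite exprAC y0E (prim_expr_order xm).
  rewrite sqrf_eq1 => /orP[] /eqP ym; last by exists y0.
  exists (- y0); rewrite sqrrN; split=> //.
  rewrite exprNn ym mulr1; suff om : odd m by rewrite -signr_odd om.
  apply/negPn/negP => /evenE[h hE].
  have xh : x ^+ h = 1 by rewrite -y0E -exprM mulnC -hE.
  have /dvdn_leq : (m %| h)%N by rewrite (prim_order_dvd xm) xh.
  by move: m0; rewrite hE; clear; lia.
exists y; split=> //.
have m20 : (0 < 2 * m)%N by rewrite muln_gt0.
have y2m : y ^+ (2 * m) = 1 by rewrite exprM yE (prim_expr_order xm).
have [r yr rdvd] := prim_order_exists m20 y2m.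
have /dvdnP[z zE] : (m %| r)%N.
  by rewrite (prim_order_dvd xm) -yE exprAC (prim_expr_order yr) expr1n.
suff <- : r = (2 * m)%N by [].
move: rdvd; rewrite zE dvdn_pmul2r // => z2.
have := dvdn_leq (ltn0Sn 1) z2; move: z2.
case: z zE => [|[|[|?]]] // zE _ _; move: oppr1_neq1.
by rewrite -ym -(prim_expr_order yr) zE mul1n eqxx.
Qed.

(** Supplies the root of unity of [Gnk] with prescribed antidiagonal entry [b]. Writing [b] as
    [(z^n)^j], one needs [i = j] modulo 2k with [i] prime to 2nk. The Chinese remainder theorem
    gives it, with moduli [k] and [2n] for k odd, and [2k] and [n] for k even. *)
Lemma prim_root_lift n k (w b : F) : coprime n k -> (n * k).-primitive_root w ->
    (2 * k).-primitive_root b ->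
  exists z, (2 * n * k).-primitive_root z /\ z ^+ n = b.
Proof.
move=> cop wP bP; have nk0 := prim_order_gt0 wP.
have [n0 k0] : (0 < n)%N /\ (0 < k)%N by apply/andP; rewrite -muln_gt0.
have [z [_ zP]] := sqrt_prim_root wP; rewrite mulnA in zP.
have znP : (2 * k).-primitive_root (z ^+ n).
  have /(dvdn_prim_root zP) : (2 * k %| 2 * n * k)%N by rewrite -mulnA mulnCA dvdn_mull.
  by rewrite -mulnA mulnCA mulnK // muln_gt0.
have [j bE] := prim_rootP znP (prim_expr_order bP).
have cj : coprime j (2 * k) by rewrite -(prim_root_exp_coprime _ znP) -bE.
suff [i [iE ci]] : exists i, (i = j %[mod 2 * k])%N /\ coprime i (2 * n * k).
  exists (z ^+ i); split; first by rewrite (prim_root_exp_coprime _ zP).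
  by rewrite exprAC bE -(prim_expr_mod znP) iE (prim_expr_mod znP).
have [ok|ek] := boolP (odd k).
  have c2 : coprime k (2 * n) by rewrite coprimeMr coprimen2 ok coprime_sym.
  exists (chinese k (2 * n) j 1); set i := chinese _ _ _ _.
  have ik : (i = j %[mod k])%N by apply: chinese_modl.
  have i2n : (i = 1 %[mod 2 * n])%N by apply: chinese_modr.
  have ci2n : coprime i (2 * n) by rewrite -coprime_modl i2n coprime_modl coprime1n.
  split; last first.
    rewrite coprimeMr ci2n -coprime_modl ik coprime_modl.
    by move: cj; rewrite coprimeMr => /andP[].
  apply/eqP; rewrite chinese_remainder ?coprime2n // ik eqxx andbT.
  move: ci2n cj; rewrite !coprimeMr !coprimen2 => /andP[oi _] /andP[oj _].
  by rewrite !modn2 oi oj.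
have on : odd n.
  apply/negPn/negP => en; move: cop => /eqP cop.
  have : (2 %| gcdn n k)%N by rewrite dvdn_gcd !dvdn2 en ek.
  by rewrite cop.
have c2 : coprime (2 * k) n by rewrite coprimeMl coprime2n on coprime_sym.
exists (chinese (2 * k) n j 1); split; first exact: chinese_modl.
set i := chinese _ _ _ _.
have ik : (i = j %[mod 2 * k])%N by apply: chinese_modl.
have i2n : (i = 1 %[mod n])%N by apply: chinese_modr.
rewrite -mulnA mulnCA coprimeMr -coprime_modl i2n coprime_modl coprime1n /=.
by rewrite -coprime_modl ik coprime_modl.
Qed.

End RootsOfUnity.

(** * Generated groups, smallness and conjugation *)

Section Groups.
Variable F : fieldType.
Implicit Types (G S : seq 'M[F]_2).

Lemma gen1 S : gen S 1%:M.
Proof. by exists [::]. Qed.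

Lemma gen_cons S s x : s \in S -> gen S x -> gen S (s *m x).
Proof.
move=> sS [ws [wsS ->]]; exists (s :: ws); split=> // t.
by rewrite inE => /orP[/eqP-> //|]; apply: wsS.
Qed.

Lemma gen_ind S (P : 'M[F]_2 -> Prop) : P 1%:M ->
    (forall s x, s \in S -> P x -> P (s *m x)) -> forall x, gen S x -> P x.
Proof.
move=> P1 PM x [ws [wsS ->]]; elim: ws wsS => //= s ws IH wsS.
apply: PM; first by apply: wsS; rewrite inE eqxx.
by apply: IH => t tws; apply: wsS; rewrite inE tws orbT.
Qed.

Lemma gen_mul S x y : gen S x -> gen S y -> gen S (x *m y).
Proof.
move=> gx gy; elim/gen_ind: x / gx => [|s x sS IH]; first by rewrite mul1mx.
by rewrite -mulmxA; apply: gen_cons.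
Qed.

Lemma invmx_uniq (x y : 'M[F]_2) : x *m y = 1%:M -> invmx x = y.
Proof.
move=> xy; have [ux _] := mulmx1_unit xy.
by rewrite -[LHS]mulmx1 -xy mulKmx.
Qed.

(** Closure of [L] under left multiplication by generators suffices, because words in [gen] grow on
    the left. *)
Lemma small_of_gen A S (L : seq 'M[F]_2) : 1%:M \in L ->
    (forall s x, s \in S -> x \in L -> s *m x \in L) ->
    (forall x, x \in L -> gen S x) -> (forall x, x \in L -> isAut A x) ->
    (forall x, x \in L -> exists2 y, y \in L & x *m y = 1%:M) ->
    (forall x, x \in L -> ~ quasi_reflection A x) ->
  exists G, (forall x, x \in G <-> gen S x) /\ small A G.
Proof.
move=> L1 LM Lg LA LV Lq; exists L.
have LP x : x \in L <-> gen S x.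
  split; first exact: Lg.
  by elim/gen_ind: x / => // s x; apply: LM.
do 3!split => //.
- by move=> g h /Lg gg /Lg gh; apply/LP/gen_mul.
- by move=> g /LV[y yL /invmx_uniq ->].
Qed.

Lemma conj_toI A G S h : isAut A h -> 1%:M \in G ->
    {in G &, forall g h, g *m h \in G} ->
    {in G, forall g, gen S (h *m g *m invmx h)} ->
    (forall s, s \in S -> exists2 g, g \in G & s = h *m g *m invmx h) ->
  conj_to A G S.
Proof.
move=> hA G1 GM Gg SG; exists h; split=> // x; split=> [[g gG ->]|]; first exact: Gg.
have [uh _] := hA.
elim/gen_ind: x / => [|s x /SG[g gG ->] [g' g'G ->]].
  by exists 1%:M => //; rewrite mulmx1 mulmxV.
exists (g *m g'); first exact: GM.
by rewrite !mulmxA mulmxKV.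
Qed.

End Groups.

Notation dg x y := (mx2 x 0 0 y) (only parsing).
Notation ag x y := (mx2 0 x y 0) (only parsing).

(** * Diagonal and antidiagonal matrices *)

Section Monomial.
Variable F : fieldType.
Implicit Types (x y : F) (G : seq 'M[F]_2).

Lemma dg1 : 1%:M = dg 1 1 :> 'M[F]_2.
Proof. by rewrite [LHS]mx2_eta !mxE. Qed.

Lemma mul_dg x y x' y' : dg x y *m dg x' y' = dg (x * x') (y * y').
Proof. by rewrite mul_mx2 !(mulr0, mul0r, addr0, add0r). Qed.

Lemma mul_dgag x y x' y' : dg x y *m ag x' y' = ag (x * x') (y * y').
Proof. by rewrite mul_mx2 !(mulr0, mul0r, addr0, add0r). Qed.

Lemma mul_agdg x y x' y' : ag x y *m dg x' y' = ag (x * y') (y * x').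
Proof. by rewrite mul_mx2 !(mulr0, mul0r, addr0, add0r). Qed.

Lemma mul_ag x y x' y' : ag x y *m ag x' y' = dg (x * y') (y * x').
Proof. by rewrite mul_mx2 !(mulr0, mul0r, addr0, add0r). Qed.

Lemma invmx_dg x y : x != 0 -> y != 0 -> invmx (dg x y) = dg x^-1 y^-1.
Proof. by move=> x0 y0; apply: invmx_uniq; rewrite mul_dg !divff // -dg1. Qed.

Lemma dgX G x y i : 1%:M \in G -> {in G &, forall g h, g *m h \in G} ->
  dg x y \in G -> dg (x ^+ i) (y ^+ i) \in G.
Proof.
move=> G1 GM xyG; elim: i => [|i IH]; first by rewrite -dg1.
by rewrite !exprS -mul_dg GM.
Qed.

(** The first coordinates form a cyclic group generated by some [w]. Since both coordinates become 1
    together, a lift [diag(w, z)] has [z] of the same order as [w], whence [z = w^a], and its powers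
    exhaust [G]. *)
Lemma diag_small_cyclic G : 1%:M \in G -> {in G &, forall g h, g *m h \in G} ->
    {in G, forall g, exists x y, [/\ x != 0, y != 0 & g = dg x y]} ->
    (forall x y, dg x y \in G -> (x == 1) = (y == 1)) ->
  exists n a w, [/\ n.-primitive_root w, (a < n)%N, coprime a n,
    dg w (w ^+ a) \in G & {in G, forall g, exists i, g = dg (w ^+ i) ((w ^+ i) ^+ a)}].
Proof.
move=> G1 GM Gd Gs; pose S := [seq g lu lu | g : 'M[F]_2 <- G].
have [|x|x y|n [w [wP wS Sw]]] := @finite_mul_cyclic F S.
- by apply/mapP; exists 1%:M => //; rewrite dg1 mx2E.
- by move=> /mapP[g /Gd[a [b [a0 _ ->]]] ->]; rewrite mx2E.
- move=> /mapP[g gG ->] /mapP[h hG ->]; apply/mapP; exists (g *m h); first exact: GM.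
  have [a [b [_ _ ->]]] := Gd _ gG; have [a' [b' [_ _ ->]]] := Gd _ hG.
  by rewrite mul_dg !mx2E.
have [z zG] : exists z, dg w z \in G.
  move/mapP: wS => [g gG wE]; have [x [y [_ _ gE]]] := Gd _ gG.
  by exists y; rewrite wE gE mx2E -gE.
have wz i : (w ^+ i == 1) = (z ^+ i == 1) by apply: Gs; apply: dgX.
have zn : z ^+ n = 1 by apply/eqP; rewrite -wz (prim_expr_order wP).
have [a zE] := prim_rootP wP zn.
have zP : n.-primitive_root z.
  have [r zr rn] := prim_order_exists (prim_order_gt0 wP) zn.
  suff <- : r = n by [].
  apply/eqP; rewrite eqn_dvd rn (prim_order_dvd wP) wz.
  by rewrite (prim_expr_order zr) eqxx.
exists n, a, w; rewrite -zE; split=> //.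
  by rewrite -(prim_root_exp_coprime _ wP) -zE.
move=> g gG; have [x [y [_ _ gE]]] := Gd _ gG.
have [i xE] : exists i, x = w ^+ i.
  by apply: Sw; apply/mapP; exists g => //; rewrite gE mx2E.
exists i; rewrite gE xE exprAC -zE; congr mx2.
(* Multiplying [g] by the inverse of [diag(w, z)^i], written as a nonnegative power, makes the first
   coordinate 1, hence also the second. *)
have := GM _ _ gG (dgX (i * n.-1) G1 GM zG); rewrite gE mul_dg => /Gs.
have iE : (i + i * n.-1 = n * i)%N.
  by have := prim_order_gt0 wP; case: (n) => // n' _; rewrite mulSn mulnC.
rewrite xE -exprD iE exprM (prim_expr_order wP) expr1n eqxx => /esym/eqP yz.
have z0 : z ^+ (i * n.-1) != 0.
  by apply/eqP => z0; move/eqP: yz; rewrite z0 mulr0 eq_sym oner_eq0.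
by apply: (mulIf z0); rewrite yz -exprD iE exprM zn expr1n.
Qed.

(** This and its converse below separate cases (i) and (ii). As [h] is monomial, a diagonal factor
    preserves its shape and an antidiagonal one exchanges the two shapes. *)
Lemma diag_not_conj_anti q (h : 'M[F]_2) x y b c : q != 1 -> isAut (Kq q) h ->
  b != 0 -> h *m dg x y = ag b c *m h -> False.
Proof.
move=> q1 /(isAut_KqP q1)[[s [t [s0 t0 ->]]]|[_ [s [t [s0 t0 ->]]]]] b0.
  rewrite mul_dg mul_agdg => /mx2_inj[_ /esym/eqP + _ _].
  by rewrite mulf_eq0 (negbTE b0) (negbTE t0).
rewrite mul_agdg mul_ag => /mx2_inj[/esym/eqP + _ _ _].
by rewrite mulf_eq0 (negbTE b0) (negbTE t0).
Qed.

Lemma anti_not_conj_diag q (h : 'M[F]_2) x y b c : q != 1 -> isAut (Kq q) h ->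
  b != 0 -> c != 0 -> h *m ag b c = dg x y *m h -> False.
Proof.
move=> q1 /(isAut_KqP q1)[[s [t [s0 t0 ->]]]|[_ [s [t [s0 t0 ->]]]]] b0 c0.
  rewrite mul_dg mul_dgag => /mx2_inj[_ /eqP + _ _].
  by rewrite mulf_eq0 (negbTE b0) (negbTE s0).
rewrite mul_dgag mul_ag => /mx2_inj[/eqP + _ _ _].
by rewrite mulf_eq0 (negbTE c0) (negbTE s0).
Qed.

Lemma gen_dg x y g : gen [:: dg x y] g -> exists i, g = dg (x ^+ i) (y ^+ i).
Proof.
elim/gen_ind: g / => [|s g]; first by exists 0%N; rewrite dg1.
by rewrite inE => /eqP-> [i ->]; exists i.+1; rewrite mul_dg !exprS.
Qed.

Lemma gen_dgX x y i : gen [:: dg x y] (dg (x ^+ i) (y ^+ i)).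
Proof.
elim: i => [|i IH]; first by rewrite -dg1; apply: gen1.
by rewrite !exprS -mul_dg; apply: gen_cons; rewrite ?inE.
Qed.

End Monomial.

(** * The listed groups are small *)

Section Converse.
Variable F : fieldType.

Lemma isAut1 (A : alg F) : isAut A 1%:M.
Proof.
rewrite dg1; case: A => [q|]; first by apply: isAut_Kq_diag; apply: oner_neq0.
by apply: isAut_KJ_scalar; apply: oner_neq0.
Qed.

Lemma prim_root_neq0 n (w : F) : n.-primitive_root w -> w != 0.
Proof.
move=> wP; apply/eqP => w0; have := prim_expr_order wP.
rewrite w0 expr0n; have := prim_order_gt0 wP; case: (n) => // m _ /esym/eqP.
by rewrite oner_eq0.
Qed.

(** As [a] is prime to n, [w^i] and [w^(ai)] are 1 for the same [i]. Both cyclic families are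
    covered, [a = 1] being the one for [KJ]. *)
Lemma small_cyclic (A : alg F) n a w :
    rel_uu A = 0 \/ a = 1%N -> n.-primitive_root w -> coprime a n ->
  exists G : seq 'M[F]_2,
    (forall x, x \in G <-> gen [:: dg w (w ^+ a)] x) /\ small A G.
Proof.
move=> Aa wP can; have n0 := prim_order_gt0 wP; have w0 := prim_root_neq0 wP.
have waP : n.-primitive_root (w ^+ a) by rewrite (prim_root_exp_coprime _ wP).
pose E i : 'M[F]_2 := dg (w ^+ i) ((w ^+ a) ^+ i).
pose L := [seq E i | i <- iota 0 n].
have EL i : E i \in L.
  apply/mapP; exists (i %% n)%N; first by rewrite mem_iota ltn_mod.
  by rewrite /E (prim_expr_mod wP) (prim_expr_mod waP).
have Aw i : rel_uu A = 0 \/ w ^+ i = (w ^+ a) ^+ i.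
  by case: Aa => [|->]; [left | right; rewrite expr1].
apply: (@small_of_gen _ _ _ L).
- by have := EL 0%N; rewrite /E -dg1.
- by move=> s x; rewrite inE => /eqP-> /mapP[i _ ->]; rewrite mul_dg -!exprS EL.
- by move=> x /mapP[i _ ->]; apply: gen_dgX.
- move=> x /mapP[i _ ->]; rewrite /E; move: (Aw i); case: (A) => [q _|[/eqP|<-]].
  + by apply: isAut_Kq_diag; rewrite ?expf_neq0.
  + by rewrite oner_eq0.
  + by apply: isAut_KJ_scalar; rewrite expf_neq0.
- move=> x /mapP[i _ ->]; exists (E (i * n.-1)%N) => //.
  have iE : (i + i * n.-1 = n * i)%N.
    by case: (n) n0 => // n' _; rewrite mulSn mulnC.
  rewrite mul_dg -!exprD iE !exprM (prim_expr_order wP).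
  by rewrite (prim_expr_order waP) !expr1n -dg1.
- move=> x /mapP[i _ ->] /(quasi_reflection_diag (Aw i)).
  by rewrite -(prim_order_dvd wP) -(prim_order_dvd waP) addbb.
Qed.

Section Gnk.
Variables (n k : nat) (w : F).
Hypothesis wP : (2 * n * k).-primitive_root w.
Let d := w ^+ (2 * k).
Let b := w ^+ n.

(** The i-th power of the diagonal generator times the j-th power of the antidiagonal one. These
    exhaust the group, since the antidiagonal generator conjugates the diagonal one to its
    inverse. *)
Definition Gnk_elt i j : 'M[F]_2 :=
  if odd j then ag (d ^+ i * b ^+ j) (d ^- i * b ^+ j)
  else dg (d ^+ i * b ^+ j) (d ^- i * b ^+ j).
Local Notation E := Gnk_elt.

Let nk0 : (0 < n)%N && (0 < k)%N.
Proof. by have := prim_order_gt0 wP; rewrite !muln_gt0. Qed.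

Lemma Gnk_dP : n.-primitive_root d.
Proof.
have /andP[n0 k0] := nk0.
have /(dvdn_prim_root wP) : (n %| 2 * n * k)%N by rewrite -mulnA mulnCA dvdn_mulr.
by rewrite -mulnA mulnCA mulKn.
Qed.

Lemma Gnk_bP : (2 * k).-primitive_root b.
Proof.
have /andP[n0 k0] := nk0.
have /(dvdn_prim_root wP) : (2 * k %| 2 * n * k)%N by rewrite -mulnA mulnCA dvdn_mull.
by rewrite -mulnA mulnCA mulnK // muln_gt0.
Qed.

Lemma Gnk_elt_ag i j : ag b b *m E i j = E (i * n.-1) j.+1.
Proof.
have dV : d ^+ (i * n.-1) = d ^- i.
  have di0 : d ^+ i != 0 by rewrite expf_neq0 ?(prim_root_neq0 Gnk_dP).
  apply: (mulIf di0); rewrite mulVf // -exprD addnC.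
  have -> : (i + i * n.-1 = n * i)%N.
    by have := prim_order_gt0 Gnk_dP; case: (n) => // n' _; rewrite mulSn mulnC.
  by rewrite exprM (prim_expr_order Gnk_dP) expr1n.
rewrite /E /= dV invrK exprS ![_ * (b * _)]mulrCA.
by case: odd; rewrite (mul_ag, mul_agdg).
Qed.

Lemma Gnk_elt_dg i j : dg d d^-1 *m E i j = E i.+1 j.
Proof.
by rewrite /E; case: odd; rewrite (mul_dgag, mul_dg) !mulrA -invfM -!exprS.
Qed.

Lemma GnkE : Gnk n k w = [:: dg d d^-1; ag b b].
Proof. by []. Qed.

Lemma gen_Gnk_elt i j : gen (Gnk n k w) (E i j).
Proof.
elim: i => [|i IH]; last first.
  by rewrite -Gnk_elt_dg; apply: gen_cons => //; rewrite GnkE !inE eqxx.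
elim: j => [|j IH]; first by rewrite /E /= expr0 invr1 mulr1 -dg1; apply: gen1.
have := Gnk_elt_ag 0 j; rewrite mul0n => <-.
by apply: gen_cons => //; rewrite GnkE !inE eqxx orbT.
Qed.

(** [i * n.-1] and [j * (2 * k).-1] stand for [-i] modulo n and [-j] modulo 2k. For odd [j] the sign
    of [i] changes twice. *)
Lemma Gnk_elt_inv i j :
  E i j *m E (if odd j then i else i * n.-1) (j * (2 * k).-1) = 1%:M.
Proof.
have /andP[n0 k0] := nk0.
have di0 : d ^+ i != 0 by rewrite expf_neq0 ?(prim_root_neq0 Gnk_dP).
have bb : b ^+ j * b ^+ (j * (2 * k).-1) = 1.
  rewrite -exprD; have -> : (j + j * (2 * k).-1 = (2 * k) * j)%N.
    by have := prim_order_gt0 Gnk_bP; case: (2 * k)%N => // m _; rewrite mulSn mulnC.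
  by rewrite exprM (prim_expr_order Gnk_bP) expr1n.
have dd : d ^+ i * d ^+ (i * n.-1) = 1.
  rewrite -exprD; have -> : (i + i * n.-1 = n * i)%N.
    by case: (n) n0 => // n' _; rewrite mulSn mulnC.
  by rewrite exprM (prim_expr_order Gnk_dP) expr1n.
have oj : odd (j * (2 * k).-1) = odd j.
  by rewrite oddM; have -> : odd (2 * k).-1 by [lia]; rewrite andbT.
rewrite /E oj; case: ifP => _; rewrite (mul_ag, mul_dg) !(mulrACA _ (b ^+ j)) bb !mulr1 dg1.
  by rewrite divff // mulVf.
by rewrite -invfM dd invr1.
Qed.

(** An antidiagonal quasi-reflection means [b^(2j) = -1] with j odd, so [k] divides 2j: then k is
    odd, as 4 does not divide 2j, and [b^(2j) = 1], a contradiction. On the diagonal part, an entry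
    1 gives [d^(ik) = 1], hence [d^i = 1] by coprimality, and both entries are 1. *)
Lemma small_Gnk : 2%:R != 0 :> F -> coprime n k -> (k %% 4 != 2)%N ->
  exists G : seq 'M[F]_2, (forall x, x \in G <-> gen (Gnk n k w) x) /\ small (Kq (-1)) G.
Proof.
move=> two cop k4; have /andP[n0 k0] := nk0.
have d0 : d != 0 := prim_root_neq0 Gnk_dP.
have b0 : b != 0 := prim_root_neq0 Gnk_bP.
pose L := [seq E ij.1 ij.2 | ij <- [seq (i, j) | i <- iota 0 n, j <- iota 0 (2 * k)]].
have EL i j : E i j \in L.
  apply/mapP; exists (i %% n, j %% (2 * k))%N.
    by apply/allpairsP; exists (i %% n, j %% (2 * k))%N; rewrite !mem_iota !ltn_mod muln_gt0 n0 k0.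
  have oj : odd (j %% (2 * k)) = odd j.
    by rewrite [in RHS](divn_eq j (2 * k)) oddD !oddM /= andbF.
  by rewrite /E /= oj !(prim_expr_mod Gnk_dP) !(prim_expr_mod Gnk_bP).
have LP x : x \in L -> exists i j, x = E i j.
  by move=> /mapP[[i j] _ ->]; exists i, j.
apply: (@small_of_gen _ _ _ L).
- by have := EL 0%N 0%N; rewrite /E /= expr0 invr1 mulr1 -dg1.
- move=> s x; rewrite GnkE !inE => /orP[] /eqP-> /LP[i [j ->]].
    by rewrite Gnk_elt_dg EL.
  by rewrite Gnk_elt_ag EL.
- by move=> x /LP[i [j ->]]; apply: gen_Gnk_elt.
- move=> x /LP[i [j ->]]; rewrite /E.
  have di0 : d ^+ i != 0 by rewrite expf_neq0.
  have bj0 : b ^+ j != 0 by rewrite expf_neq0.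
  by case: odd; [apply: isAut_Kq_anti|apply: isAut_Kq_diag];
     apply: mulf_neq0; rewrite ?invr_eq0.
- by move=> x /LP[i [j ->]]; eexists; last exact: Gnk_elt_inv.
move=> x /LP[i [j ->]]; rewrite /E; case: ifP => oj.
  have di0 : d ^+ i != 0 by rewrite expf_neq0.
  move/(quasi_reflection_anti _ _ two); rewrite mulrACA (divff di0) mul1r -exprD addnn => bj.
  have n1 : -1 != 1 :> F by rewrite eq_sym -subr_eq0 opprK.
  have : (2 * k %| 2 * j.*2)%N.
    by rewrite (prim_order_dvd Gnk_bP) mulnC exprM bj sqrrN expr1n.
  rewrite dvdn_pmul2l // => /dvdnP[z zE].
  have [ok|ek] := boolP (odd k); last first.
    have /dvdnP[q kE] : (4 %| k)%N by move: k4 ek; clear; lia.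
    by move: zE oj; rewrite kE mulnA; move: (z * q)%N; clear; lia.
  have [t tE] : exists t, z = (t * 2)%N.
    by apply: evenE; apply/negP => oz; have := congr1 odd zE; rewrite odd_double oddM oz ok.
  by move: n1; rewrite -bj zE tE -mulnA exprM exprAC (prim_expr_order Gnk_bP) expr1n eqxx.
have [t tE] : exists t, j = (t * 2)%N by apply: evenE; rewrite oj.
have bt : (b ^+ j) ^+ k = 1.
  by rewrite -exprM tE -mulnA mulnC exprM (prim_expr_order Gnk_bP) expr1n.
have key e : (e == d ^+ i) || (e == d ^- i) -> e * b ^+ j = 1 -> d ^+ i = 1.
  move=> ed eb; have dk : d ^+ (i * k) = 1.
    have := congr1 (fun x => x ^+ k) eb; rewrite exprMn bt mulr1 expr1n.
    case/orP: ed => /eqP->; first by rewrite -exprM.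
    by rewrite exprVn -exprM => ei; apply: invr_inj; rewrite invr1.
  apply/eqP; rewrite -(prim_order_dvd Gnk_dP) -(Gauss_dvdl _ cop).
  by rewrite (prim_order_dvd Gnk_dP) dk.
have Kq0 : rel_uu (Kq (-1 : F)) = 0 \/ d ^+ i * b ^+ j = d ^- i * b ^+ j by left.
move/(quasi_reflection_diag Kq0).
have [e1|e1] := eqVneq (d ^+ i * b ^+ j) 1 => /=.
  have di := key _ (introT orP (or_introl (eqxx _))) e1.
  by move: e1; rewrite di invr1 => ->; rewrite eqxx.
move=> /eqP e2; have di := key _ (introT orP (or_intror (eqxx _))) e2.
by move: e2 e1; rewrite di invr1 => ->; rewrite eqxx.
Qed.

End Gnk.
End Converse.

(** * Classification of small groups *)

Section Classification.
Variable F : closedFieldType.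
Hypothesis charF0 : [pchar F] =i pred0.

Let two : 2%:R != 0 :> F.
Proof. by have /pcharf0P -> := charF0. Qed.

Lemma caseI_of_diag q (G : seq 'M[F]_2) : q != 1 -> small (Kq q) G -> nontrivial G ->
    {in G, forall g, exists x y, [/\ x != 0, y != 0 & g = dg x y]} ->
  caseI (Kq q) G.
Proof.
move=> q1 [[G1 GA GM GV] Gq] [g0 g0G g01] Gd; split; first by exists q.
have [|n [a [w [wP an can wG Gw]]]] := diag_small_cyclic G1 GM Gd.
  move=> x y /Gq; have Kq0 : rel_uu (Kq q) = 0 \/ x = y by left.
  by rewrite (quasi_reflection_diag Kq0); case: (x == 1); case: (y == 1) => // -[].
exists n, a, w; split=> //.
  (* If [a = 0], coprimality forces [n = 1], against nontriviality. *)
  rewrite an andbT lt0n; apply/eqP => a0; move: can an; rewrite a0 /coprime gcd0n => /eqP n1 _.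
  have [i gE] := Gw _ g0G; move: g01; rewrite gE.
  have := prim_expr_order wP; rewrite n1 expr1 => ->.
  by rewrite !expr1n -dg1 eqxx.
apply: conj_toI (isAut1 _) G1 GM _ _ => [g gG|s].
  by have [i ->] := Gw _ gG; rewrite invmx1 mul1mx mulmx1 exprAC; apply: gen_dgX.
by rewrite inE => /eqP ->; exists (dg w (w ^+ a)); rewrite ?invmx1 ?mul1mx ?mulmx1.
Qed.

(** The elements are [x] times unipotent matrices; in characteristic 0 a nonzero off-diagonal entry
    would give infinitely many powers. *)
Lemma caseIII_of_KJ (G : seq 'M[F]_2) : small KJ G -> nontrivial G -> caseIII KJ G.
Proof.
move=> [[G1 GA GM GV] _] [g0 g0G g01]; split=> //.
have Gu g : g \in G -> exists x b, x != 0 /\ g = mx2 x b 0 x by move/GA/isAut_KJP.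
have mulu (x b x' b' : F) : mx2 x b 0 x *m mx2 x' b' 0 x' = mx2 (x * x') (x * b' + b * x') 0 (x * x').
  by rewrite mul_mx2 !(mulr0, mul0r, addr0, add0r).
pose S := [seq g lu lu | g : 'M[F]_2 <- G].
have [|x|x y|n [w [wP wS Sw]]] := @finite_mul_cyclic F S.
- by apply/mapP; exists 1%:M => //; rewrite dg1 mx2E.
- by move=> /mapP[g /Gu[a [b [a0 ->]]] ->]; rewrite mx2E.
- move=> /mapP[g gG ->] /mapP[h hG ->]; apply/mapP; exists (g *m h); first exact: GM.
  have [a [b [_ ->]]] := Gu _ gG; have [a' [b' [_ ->]]] := Gu _ hG.
  by rewrite mulu !mx2E.
have Gs g : g \in G -> exists i, g = dg (w ^+ i) (w ^+ i).
  move=> gG; have [x [b [x0 gE]]] := Gu _ gG.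
  have [i xE] : exists i, x = w ^+ i.
    by apply: Sw; apply/mapP; exists g => //; rewrite gE mx2E.
  have GX j : mx2 (x ^+ j) (j%:R * x ^+ j.-1 * b) 0 (x ^+ j) \in G.
    elim: j => [|j IH]; first by rewrite mul0r mul0r -dg1.
    have := GM _ _ gG IH; rewrite gE mulu -exprS /=.
    have -> // : x * (j%:R * x ^+ j.-1 * b) + b * x ^+ j = j.+1%:R * x ^+ j * b.
    case: j {IH} => [|j] /=; first by rewrite !expr0; ring.
    by rewrite -[j.+2%:R]natr1 exprS; ring.
  suff b0 : b = 0 by exists i; rewrite gE b0 xE.
  apply/eqP/negPn/negP => b0.
  (* [f j] is the power of [g] with exponent nj. As [x^n = 1], its off-diagonal entry is [j] times a
     nonzero constant, so [size G + 1] of these matrices cannot all lie in [G]. *)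
  pose f j : 'M[F]_2 := mx2 (x ^+ (n * j)) ((n * j)%:R * x ^+ (n * j).-1 * b) 0 (x ^+ (n * j)).
  have finj : injective f.
    move=> j j' /mx2_inj[_ + _ _].
    have xn t : (n * t)%:R * x ^+ (n * t).-1 * b = t%:R * (n%:R * x^-1 * b).
      rewrite natrM; case: t => [|t]; first by rewrite !(mulr0, mul0r).
      suff -> : x ^+ (n * t.+1).-1 = x^-1 by ring.
      apply: (mulIf x0); rewrite mulVf // -exprSr prednK ?muln_gt0 ?(prim_order_gt0 wP) //.
      by rewrite exprM xE [_ ^+ n]exprAC (prim_expr_order wP) !expr1n.
    have nz : n%:R * x^-1 * b != 0.
      rewrite !mulf_neq0 ?invr_eq0 //; have /pcharf0P -> := charF0.
      by rewrite -lt0n (prim_order_gt0 wP).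
    rewrite !xn => /(mulIf nz) /eqP; have := charF0 => /pcharf0P cF.
    wlog le : j j' / (j <= j')%N => [W|].
      by case/orP: (leq_total j j') => le; [|rewrite eq_sym => e; apply/esym; move: e]; apply: W.
    by rewrite eq_sym -subr_eq0 -natrB // cF subn_eq0 => le'; apply/eqP; rewrite eqn_leq le.
  have := @uniq_leq_size _ [seq f j | j <- iota 0 (size G).+1] G.
  rewrite map_inj_uniq // iota_uniq size_map size_iota ltnn => /(_ isT) contra.
  by have : false by apply: contra => _ /mapP[j _ ->]; apply: GX.
exists n, w; split=> //.
  rewrite ltn_neqAle (prim_order_gt0 wP) andbT; apply/eqP => n1.
  have [i gE] := Gs _ g0G; move: g01; rewrite gE.
  have := prim_expr_order wP; rewrite -n1 expr1 => ->.
  by rewrite !expr1n -dg1 eqxx.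
have wG : dg w w \in G.
  move/mapP: wS => [g gG wE]; have [i gE] := Gs _ gG.
  by rewrite wE gE mx2E -gE.
apply: conj_toI (isAut1 _) G1 GM _ _ => [g gG|s].
  by have [i ->] := Gs _ gG; rewrite invmx1 mul1mx mulmx1; apply: gen_dgX.
by rewrite inE => /eqP ->; exists (dg w w); rewrite ?invmx1 ?mul1mx ?mulmx1.
Qed.

Lemma caseII_of_anti (G : seq 'M[F]_2) b0 c0 : small (Kq (-1)) G ->
  ag b0 c0 \in G -> caseII (Kq (-1)) G.
Proof.
move=> [[G1 GA GM GV] Gq] g0G; split=> //.
have n1 := oppr1_neq1 two.
have GP g : g \in G -> (exists x y, [/\ x != 0, y != 0 & g = dg x y]) \/
    (exists x y, [/\ x != 0, y != 0 & g = ag x y]).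
  by move=> /GA /(isAut_KqP n1) [|[_]]; [left|right].
have nz b c : ag b c \in G -> b != 0 /\ c != 0.
  by move=> /GA[]; rewrite unit_mx2 mul0r sub0r oppr_eq0 mulf_eq0 negb_or => /andP.
pose D := [seq g : 'M[F]_2 <- G | g lu lv == 0].
have DG x y : dg x y \in D = (dg x y \in G) by rewrite mem_filter mx2E eqxx.
have [| | | |m [a' [w [wP am can wD Dw]]]] := @diag_small_cyclic F D.
- by rewrite dg1 DG -dg1.
- move=> g h; rewrite !mem_filter => /andP[g0 gG] /andP[h0 hG].
  rewrite GM // andbT.
  case: (GP _ gG) g0 => [[x [y [_ _ ->]]] _|[x [y [x0 _ ->]]]]; last by rewrite mx2E (negbTE x0).
  case: (GP _ hG) h0 => [[x' [y' [_ _ ->]]] _|[x' [y' [x0 _ ->]]]]; last by rewrite mx2E (negbTE x0).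
  by rewrite mul_dg mx2E.
- move=> g; rewrite mem_filter => /andP[g0 /GP[//|[x [y [x0 _ gE]]]]].
  by move: g0; rewrite gE mx2E (negbTE x0).
- move=> x y; rewrite DG => /Gq; have Kq0 : rel_uu (Kq (-1 : F)) = 0 \/ x = y by left.
  by rewrite (quasi_reflection_diag Kq0); case: (x == 1); case: (y == 1) => // -[].
have m0 := prim_order_gt0 wP; have w0 := prim_root_neq0 wP.
(* Adding m keeps all powers of [w] and makes the exponent positive even when [a' = 0], which
   happens for [m = 1]. *)
pose a := (a' + m)%N.
have wa i : (w ^+ i) ^+ a' = (w ^+ i) ^+ a.
  by rewrite exprD [_ ^+ m]exprAC (prim_expr_order wP) expr1n mulr1.
have dgG x y : dg x y \in G -> exists i, x = w ^+ i /\ y = (w ^+ i) ^+ a.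
  by rewrite -DG => /Dw[i]; rewrite wa => /mx2_inj[-> _ _ ->]; exists i.
have Gdg i : dg (w ^+ i) ((w ^+ i) ^+ a) \in G.
  by rewrite -wa [_ ^+ a']exprAC; apply: dgX => //; rewrite -DG.
(* The square of the antidiagonal element is the scalar matrix [b0 c0], which lies in the diagonal
   part. *)
have [e [bcE bcE']] := dgG _ _ (eq_ind _ (fun x => x \in G) (GM _ _ g0G g0G) _ (mul_ag _ _ _ _)).
have a0 : (0 < a)%N by rewrite addn_gt0 m0 orbT.
have ea : (e * a = e %[mod m])%N.
  by apply/eqP; rewrite -(eq_prim_root_expr wP) exprM -bcE' mulrC bcE.
have aa : (a * a = 1 %[mod m])%N.
  (* Sandwiching [diag(w, w^a)] between two copies of the antidiagonal element gives a diagonal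
     matrix with exponents [e+a] and [e+1]. *)
  have := GM _ _ (GM _ _ g0G (Gdg 1%N)) g0G; rewrite expr1 mul_agdg mul_ag => /dgG[i [E1 E2]].
  have : (e + 1 == (e + a) * a %[mod m])%N.
    rewrite -(eq_prim_root_expr wP) exprD expr1 exprM exprD -bcE.
    have -> : b0 * c0 * w ^+ a = w ^+ i by rewrite -E1; ring.
    by rewrite -E2; apply/eqP; ring.
  by rewrite mulnDl -(modnDml (e * a)) ea modnDml eqn_modDl => /eqP ->.
have half : ~~ odd m -> forall j, (e + a.+1 * j <> m./2 %[mod m])%N.
  move=> em j /eqP; rewrite -(eq_prim_root_expr wP) => /eqP ej.
  have := GM _ _ g0G (Gdg j); rewrite mul_agdg => /Gq.
  apply; apply/(quasi_reflection_anti _ _ two).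
  transitivity (w ^+ (e + a.+1 * j)).
    by rewrite exprD -bcE mulSn exprD mulnC exprM; ring.
  have [M mM] := evenE em; rewrite ej mM muln2 doubleK.
  have : (w ^+ M) ^+ 2 == 1 by rewrite -exprM -mM (prim_expr_order wP).
  rewrite sqrf_eq1 => /orP[|/eqP //]; rewrite -(prim_order_dvd wP) => /dvdn_leq.
  by move: m0; rewrite mM; clear; lia.
have [n [k [j [[nkm cop na ka] [k4 jE]]]]] := split_modulus m0 a0 aa ea half.
have n0 : (0 < n)%N by move: m0; rewrite -nkm muln_gt0 => /andP[].
have k0 : (0 < k)%N by move: m0; rewrite -nkm muln_gt0 => /andP[].
have [b [c [gG bc]]] : exists b c, ag b c \in G /\ b * c = w ^+ n.
  exists (b0 * (w ^+ j) ^+ a), (c0 * w ^+ j); split.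
    by rewrite -mul_agdg GM.
  transitivity (w ^+ (e + a.+1 * j)).
    by rewrite exprD -bcE mulSn exprD mulnC exprM; ring.
  by apply/eqP; rewrite (eq_prim_root_expr wP) jE.
have [bn0 cn0] := nz _ _ gG.
have wnP : k.-primitive_root (w ^+ n).
  have /(dvdn_prim_root wP) : (k %| m)%N by rewrite -nkm dvdn_mull.
  by rewrite -nkm mulnK.
have [be [beE beP]] := sqrt_prim_root two wnP.
have wP' := wP; rewrite -nkm in wP'.
have [z [zP zn]] := prim_root_lift two cop wP' beP.
exists n, k, z; split=> //; split=> //.
have be0 := prim_root_neq0 beP.
(* Conjugation by [h] fixes diagonal matrices and turns [ag b c] into [ag be be], because
   [be^2 = bc]. *)
pose h : 'M[F]_2 := dg (be / b) 1.
have s0 : be / b != 0 by rewrite mulf_neq0 ?invr_eq0.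
have hV : invmx h = dg (be / b)^-1 1 by rewrite /h invmx_dg ?oner_neq0 // invr1.
have hdg x y : h *m dg x y *m invmx h = dg x y.
  by rewrite hV !mul_dg mul1r mulr1 mulrAC mulfV // mul1r.
have hg : h *m ag b c *m invmx h = ag be be.
  rewrite hV mul_dgag mul_agdg mulr1 divfK // mul1r; congr mx2.
  by apply: (mulIf be0); rewrite -expr2 beE -bc; field; rewrite bn0 be0.
have dP := Gnk_dP zP.
set d := z ^+ (2 * k) in dP.
have da : d ^+ a = d^-1.
  apply: (mulIf (prim_root_neq0 dP)); rewrite mulVf ?(prim_root_neq0 dP) // -exprSr.
  by apply/eqP; rewrite -(prim_order_dvd dP).
have gdg x y : dg x y \in G -> gen (Gnk n k z) (dg x y).
  move=> /dgG[i [-> ->]].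
  (* By Bezout [w^i] is an n-th root of unity times a power of [w^n]. Raising to the power [a]
     inverts the first factor, as n divides [a+1], and fixes the second, as k divides [a-1]. *)
  have [u v E _] := @egcdnP n k n0; rewrite (eqP cop) in E.
  pose r := (w ^+ (v * k * i))^-1.
  have rn : r ^+ n = 1.
    rewrite exprVn -exprM; have -> : (v * k * i * n = m * (v * i))%N by rewrite -nkm; ring.
    by rewrite exprM (prim_expr_order wP) expr1n invr1.
  have [p rE] := prim_rootP dP rn.
  have wi : w ^+ i = d ^+ p * z ^+ n ^+ (2 * (u * i)).
    rewrite -rE zn exprM beE -exprM mulnA [(n * u)%N]mulnC E mulnDl mul1n exprD /r.
    by rewrite mulKf // expf_neq0.
  have -> : (w ^+ i) ^+ a = d ^- p * z ^+ n ^+ (2 * (u * i)).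
    rewrite wi exprMn [_ ^+ a]exprAC da exprVn; congr (_ * _).
    rewrite zn exprM beE [LHS]exprAC; congr (_ ^+ _).
    rewrite -(prednK a0) exprS; have /eqP -> : (w ^+ n) ^+ a.-1 == 1.
      by rewrite -(prim_order_dvd wnP).
    by rewrite mulr1.
  rewrite wi; have := gen_Gnk_elt zP p (2 * (u * i)).
  by rewrite /Gnk_elt oddM /= -/d.
have hA : isAut (Kq (-1)) h by apply: isAut_Kq_diag; rewrite ?oner_neq0.
have [uh _] := hA.
apply: (conj_toI hA G1 GM) => [g1 g1G|s].
  case: (GP _ g1G) => [[x [y [_ _ g1E]]]|[x [y [_ _ g1E]]]].
    by rewrite g1E hdg; apply: gdg; rewrite -g1E.
  (* Antidiagonal elements reduce to diagonal ones on multiplication by [ag b c], whose conjugate is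
     the second generator. *)
  have [x' [y' g1g]] : exists x' y', g1 *m ag b c = dg x' y'.
    by rewrite g1E mul_ag; do 2!eexists.
  have inv := Gnk_elt_inv zP 0 1.
  have E01 : Gnk_elt n k z 0 1 = ag be be by rewrite /Gnk_elt /= zn invr1 mul1r expr1.
  have -> : h *m g1 *m invmx h =
      dg x' y' *m Gnk_elt n k z (if odd 1 then 0 else 0 * n.-1) (1 * (2 * k).-1).
    rewrite -[LHS]mulmx1 -[X in _ *m X = _]inv E01 -hg -(hdg x' y') -g1g.
    by rewrite !mulmxA mulmxKV.
  apply: gen_mul; last exact: gen_Gnk_elt.
  by apply: gdg; rewrite -g1g GM.
rewrite !inE => /orP[] /eqP ->; last by exists (ag b c); rewrite // hg zn.
have [i dE] : exists i, d = w ^+ i.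
  have dm : d ^+ m = 1 by rewrite -nkm exprM (prim_expr_order dP) expr1n.
  by have [i ->] := prim_rootP wP dm; exists i.
exists (dg d d^-1); last by rewrite hdg.
by have := Gdg i; rewrite -dE da.
Qed.
End Classification.

Theorem mainTheorem1 (F : closedFieldType) (charF0 : [pchar F] =i pred0) :
  (forall (A : alg F) (G : seq 'M[F]_2),
     noncomm A -> small A G -> nontrivial G ->
     exactly_one (caseI A G) (caseII A G) (caseIII A G))
  /\
  (forall (q : F) (n a : nat) (w : F),
     q != 0 -> q != 1 -> (1 <= a < n)%N -> coprime a n -> n.-primitive_root w ->
     exists G : seq 'M[F]_2,
       (forall x, x \in G <-> gen [:: mx2 w 0 0 (w ^+ a)] x) /\ small (Kq q) G)
  /\
  (forall (n k : nat) (w : F),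
     (0 < n)%N -> (0 < k)%N -> coprime n k -> (k %% 4 != 2)%N ->
     (2 * n * k).-primitive_root w ->
     exists G : seq 'M[F]_2,
       (forall x, x \in G <-> gen (Gnk n k w) x) /\ small (Kq (-1)) G)
  /\
  (forall (n : nat) (w : F),
     (2 <= n)%N -> n.-primitive_root w ->
     exists G : seq 'M[F]_2,
       (forall x, x \in G <-> gen [:: mx2 w 0 0 w] x) /\ small KJ G).
Proof.
have two : 2%:R != 0 :> F by have /pcharf0P -> := charF0.
split; last split; last split.
- move=> [q|] G; last first.
    move=> _ Gsm Gnt; right; right; split; first by move=> [[q []]].
    by split; [case | apply: caseIII_of_KJ].
  move=> /andP[_ q1] Gsm Gnt; have [[_ GA _ _] _] := Gsm.
  have nIII : ~ caseIII (Kq q) G by case.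
  (* Automorphisms being monomial, a nonzero upper right entry marks an antidiagonal element; its
     presence decides between (ii) and (i). *)
  have [/hasP[g gG ganti]|/hasPn Gdiag] := boolP (has (fun g : 'M[F]_2 => g lu lv != 0) G).
    right; left; have [|[qE [b [c [b0 c0 gE]]]]] := isAut_KqP q1 (GA _ gG).
      by move=> [x [y [_ _ gE]]]; move: ganti; rewrite gE mx2E eqxx.
    rewrite gE in gG; split; last by split=> //; rewrite qE; apply: (caseII_of_anti charF0 _ gG); rewrite -qE.
    move=> [_ [n [a [w [_ _ _ [h [hA hG]]]]]]].
    have /hG/gen_dg[i E] : exists2 g', g' \in G & h *m ag b c *m invmx h = h *m g' *m invmx h.
      by exists (ag b c).
    by apply: (anti_not_conj_diag q1 hA b0 c0 (x := w ^+ i) (y := w ^+ a ^+ i)); rewrite -E mulmxKV //; case: hA.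
  have Gd : {in G, forall g, exists x y, [/\ x != 0, y != 0 & g = dg x y]}.
    move=> g gG; have [//|[_ [b [c [b0 _ gE]]]]] := isAut_KqP q1 (GA _ gG).
    by have := Gdiag _ gG; rewrite gE mx2E b0.
  left; split; first exact: caseI_of_diag.
  split=> // -[qE [n [k [w [_ _ _ _ [wP [h [hA hG]]]]]]]].
  have gw : gen (Gnk n k w) (ag (w ^+ n) (w ^+ n)).
    by rewrite -[X in gen _ X]mulmx1; apply: gen_cons (gen1 _); rewrite !inE eqxx orbT.
  have [g gG E] := (hG _).2 gw; have [x [y [_ _ gE]]] := Gd _ gG.
  apply: (diag_not_conj_anti q1 hA (x := x) (y := y) (b := w ^+ n) (c := w ^+ n)).
    by rewrite expf_neq0 // (prim_root_neq0 wP).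
  by rewrite E -gE mulmxKV //; case: hA.
- move=> q n a w _ _ _ can wP.
  exact: (@small_cyclic _ (Kq q) _ _ _ (or_introl erefl) wP can).
- by move=> n k w _ _ cop k4 wP; apply: small_Gnk.
- move=> n w n2 wP; have [G GP] := @small_cyclic _ KJ _ _ _ (or_intror erefl) wP (coprime1n n).
  by exists G; rewrite expr1 in GP.
Qed.
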